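(* Let $R$ be a commutative noetherian ring of (finite) Krull dimension $d$. If there exists a positive integer $s$ such that $\mathsf{ca}^{s}(R/\mathfrak p)\neq 0$ for each $\mathfrak p\in\mathrm{Spec}\,R$, then there exist a finitely generated $R$-module $G$ and an integer $n$ such that $\Omega^{s+d-1}_{R}(\mathrm{mod}\,R)\subseteq |G|_{n}$. In particular, $\mathrm{mod}\,R$ has a strong generator.
   Context: For a commutative noetherian ring $R$, $\mathrm{mod}\,R$ is the category of finitely generated $R$-modules. For $n\ge 0$, $\mathsf{ca}^{n}(R)$ is the ideal of all $a\in R$ with $a\,\mathrm{Ext}^{i}_{R}(M,N)=0$ for all $M,N\in\mathrm{mod}\,R$ and all $i\ge n$. Syzygies: $\Omega_{R}M$ is the kernel of a surjection $P\to M$ with $P$ a finitely generated projective module; $\Omega^{0}M=M$ and $\Omega^{n}M=\Omega(\Omega^{n-1}M)$. Syzygies are defined up to projective summands. $\Omega^{s}_{R}(\mathrm{mod}\,R)=\{\Omega^{s}_{R}M\mid M\in\mathrm{mod}\,R\}$. For $G\in\mathrm{mod}\,R$, $\mathrm{add}\,G$ consists of direct summands of finite direct sums of copies of $G$; $|G|_{0}=\{0\}$, $|G|_{1}=\mathrm{add}\,G$, and for $n\ge 2$, $|G|_{n}$ consists of the $M\in\mathrm{mod}\,R$ that fit into an exact sequence $0\to Y\to M\oplus W\to X\to 0$ with $Y\in|G|_{n-1}$ and $X\in\mathrm{add}\,G$ (for some $W\in\mathrm{mod}\,R$). A strong generator for $\mathrm{mod}\,R$ is a finitely generated $R$-module $G$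 such that $R$ is a direct summand of $G$ and there exist non-negative integers $s,n$ with $\Omega^{s}_{R}(\mathrm{mod}\,R)\subseteq|G|_{n}$. *)

(* Defs.v *)
From HB Require Import structures.
From mathcomp Require Import all_boot all_order all_algebra.
From mathcomp Require Import classical_sets.

Set Implicit Arguments.
Unset Strict Implicit.
Unset Printing Implicit Defensive.

Import GRing.Theory.
Local Open Scope ring_scope.
Local Open Scope classical_set_scope.

Definition is_ideal (R : comNzRingType) (I : set R) : Prop :=
  [/\ I 0, forall x y, I x -> I y -> I (x + y) & forall a x, I x -> I (a * x)].

Definition noetherian (R : comNzRingType) : Prop :=
  forall I : set R, is_ideal I ->
    exists (n : nat) (g : 'I_n -> R),
      I = [set x | exists c : 'I_n -> R, x = \sum_i c i * g i].

(* [prime_idealr] requires 1 \notin p, so these are proper prime ideals.  The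
   chain p_0 < ... < p_n has length n. *)
Definition prime_chain (R : comNzRingType) (n : nat)
    (p : 'I_n.+1 -> prime_idealr R) : Prop :=
  forall i j : 'I_n.+1, (i < j)%N -> [set` p i] `<` [set` p j].

Definition has_krull_dim (R : comNzRingType) (d : nat) : Prop :=
  (exists p : 'I_d.+1 -> prime_idealr R, prime_chain p) /\
  (forall (n : nat) (p : 'I_n.+1 -> prime_idealr R),
     prime_chain p -> (n <= d)%N).

Section Modules.
Variable R : comNzRingType.
Implicit Types (M N P K W X Y G : lmodType R) (n s : nat).

Definition fin_gen M : Prop :=
  exists (n : nat) (g : 'I_n -> M),
    forall x : M, exists c : 'I_n -> R, x = \sum_i c i *: g i.

Definition surj (A B : Type) (f : A -> B) : Prop := range f = setT.

Definition exact_at (A B C : lmodType R) (f : {linear A -> B})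
    (g : {linear B -> C}) : Prop :=
  range f = [set y | g y = 0].

Definition short_exact (A B C : lmodType R) (f : {linear A -> B})
    (g : {linear B -> C}) : Prop :=
  [/\ injective f, exact_at f g & surj g].

Definition iso M N : Prop := exists f : {linear M -> N}, bijective f.

Definition direct_summand N M : Prop :=
  exists W, iso (N * W)%type M.

Definition projective P : Prop :=
  forall (A B : lmodType R) (g : {linear A -> B}) (f : {linear P -> B}),
    surj g -> exists h : {linear P -> A}, forall x, g (h x) = f x.

Record proj_resolution M := ProjResolution {
  res_obj : nat -> lmodType R;
  res_diff : forall i, {linear res_obj i.+1 -> res_obj i};
  res_aug : {linear res_obj 0 -> M};
  res_proj : forall i, projective (res_obj i);
  res_aug_surj : surj res_aug;
  res_exact0 : exact_at (res_diff 0) res_aug;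
  res_exact : forall i, exact_at (res_diff i.+1) (res_diff i) }.

(* Cocycles and coboundaries of degree i in the complex Hom_R(P_*, N), whose
   i-th cohomology is Ext^i_R(M, N). *)
Definition ext_cocycle M (P : proj_resolution M) N (i : nat)
    (f : res_obj P i -> N) : Prop :=
  linear f /\ forall x, f (res_diff P i x) = 0.

Definition ext_coboundary M (P : proj_resolution M) N (i : nat) :
    (res_obj P i -> N) -> Prop :=
  match i with
  | 0 => fun f => forall x, f x = 0
  | j.+1 => fun f =>
      exists g : {linear res_obj P j -> N}, forall x, f x = g (res_diff P j x)
  end.

(* a Ext^i_R(M, N) = 0: as Ext^i is cocycles modulo coboundaries, this says that
   a sends every cocycle to a coboundary.  Ext^i does not depend on the
   resolution, so any of them may be used. *)
Definition ext_killed (a : R) (i : nat) M N : Prop :=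
  forall (P : proj_resolution M) (f : res_obj P i -> N),
    ext_cocycle f -> ext_coboundary (fun x => a *: f x).

Definition ca n : set R :=
  [set a | forall M N (i : nat),
     fin_gen M -> fin_gen N -> (n <= i)%N -> ext_killed a i M N].

(* Syzygies are defined only up to projective summands (and isomorphism), hence
   relations: K is one of the possible choices of the syzygy of M. *)
Definition is_syzygy1 M K : Prop :=
  exists P (f : {linear K -> P}) (g : {linear P -> M}),
    [/\ fin_gen P, projective P & short_exact f g].

Fixpoint is_syzygy n M K : Prop :=
  match n with
  | 0 => iso M K
  | k.+1 => exists2 L : lmodType R, is_syzygy k M L & is_syzygy1 L K
  end.

Definition Omega_mod s K : Prop :=
  exists2 M : lmodType R, fin_gen M & is_syzygy s M K.

Definition add_mod G M : Prop :=
  exists m : nat, direct_summand M {ffun 'I_m -> G}.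

Fixpoint ball G n M : Prop :=
  match n with
  | 0 => forall x : M, x = 0
  | 1 => add_mod G M
  | (_.+1 as k).+1 => fin_gen M /\
      exists W Y X (f : {linear Y -> (M * W)%type})
             (g : {linear (M * W)%type -> X}),
        [/\ fin_gen W, ball G k Y, add_mod G X & short_exact f g]
  end.

Definition strong_generator G : Prop :=
  [/\ fin_gen G, direct_summand R^o G &
      exists s n : nat, forall K, Omega_mod s K -> ball G n K].

End Modules.

Arguments ca R n : clear implicits.

(* Main.v *)
(* For an ideal I, work with R-modules killed by I and their syzygies over R/I,
   all inside R-modules; call a class of modules bounded if it lies in |G|_n for
   one finitely generated G and one n.  The claim is that the syzygies of order
   s + dim(R/I) - 1 over R/I form a bounded class.

   If ab lies in I and a, b do not, then 0 -> aM -> M -> M/aM -> 0 and the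
   horseshoe lemma reduce the claim for I to I + (a) and I + (b), because a
   syzygy over R/I of an R/J-module is built from its syzygies over R/J and the
   syzygies over R/I of R/J.  By noetherian induction I may be taken prime.

   If I = p is prime, pick a outside p whose class kills Ext^i over R/p for all
   i >= s.  For a syzygy X of order s + dim(R/p) - 1 with cover 0 -> Z -> P -> X
   -> 0, a kills Ext^1(X, Z), so a.id_Z extends to P -> Z.  As X is torsion-free
   this gives an exact sequence 0 -> X * Z -> P -> X/aX -> 0, so X is built from P
   and an R-syzygy of X/aX, and X/aX is a syzygy over R/(p + (a)) of order one
   less, where the dimension has dropped. *)
Require Import Defs.
From HB Require Import structures.
From mathcomp Require Import all_boot all_order all_algebra.
From mathcomp Require Import classical_sets boolp.

Set Implicit Arguments.
Unset Strict Implicit.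
Unset Printing Implicit Defensive.

Import GRing.Theory.
Local Open Scope ring_scope.
Local Open Scope classical_set_scope.
Local Open Scope quotient_scope.

(** Boundedness always refers to R-modules, even for syzygies over R/I, so that the generators found
    for different ideals can be collected into one [G]. The price is that the steps building X/aX
    may leave the modules killed by p, which is why its syzygy K is taken over R. With an R-cover Q
    of X/aX, the sequence 0 -> X * Z -> P -> X/aX -> 0 turns into 0 -> K -> (X * Z) * Q -> P -> 0,
    and X is a summand of the middle term.

    The order s + d - 1 has two sources. If X is a syzygy of M of order k, then Ext^1(X, Z) is
    Ext^{k+1}(M, Z), so k must be at least s - 1; this suffices in dimension 0, where p + (a) is the
    whole ring and X/aX vanishes. Each further dimension costs one order: M may have a-torsion, so
    the reduction modulo a starts from its first syzygy, which embeds in a projective R/p-module.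

    The projective summands that Schanuel's lemma produces do no harm, since they are summands of
    powers of the single module R/I. *)

Definition submod_set (R : comNzRingType) (M : lmodType R) (S : set M) :=
  [/\ S 0, forall x y, S x -> S y -> S (x + y) & forall a x, S x -> S (a *: x)].

(** * Submodules and quotient modules *)

Section SubmoduleTypes.
Variables (R : comNzRingType) (M : lmodType R) (S : set M).
Hypothesis hS : submod_set S.

(* The proof is an argument of the predicate so that the closure instance below
   can be keyed on it. *)
Definition in_sub (hS : submod_set S) (x : M) : bool := `[< S x >].

Fact in_sub_submod : submod_closed (in_sub hS).
Proof.
case: hS => S0 SD SZ; split; first exact/asboolP.
by move=> a x y /asboolP Sx /asboolP Sy; apply/asboolP/SD => //; apply: SZ.
Qed.

HB.instance Definition _ := GRing.isSubmodClosed.Build R M (in_sub hS)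
  in_sub_submod.

Record sub_type := SubType { sub_val : M; _ : in_sub hS sub_val }.
HB.instance Definition _ := [isSub for sub_val].
HB.instance Definition _ := [Choice of sub_type by <:].
HB.instance Definition _ := [SubChoice_isSubLmodule of sub_type by <:].

(** Later arguments use submodules only through this injection with prescribed range, and quotients
    only through the surjection with prescribed kernel of [quo_exists]; the concrete types do not
    reappear. *)
Lemma sub_exists : exists (K : lmodType R) (f : {linear K -> M}),
  injective f /\ forall x, S x <-> exists k, f k = x.
Proof.
exists sub_type, (val : {linear sub_type -> M}); split; first exact: val_inj.
move=> x; split=> [Sx|[k <-]]; last by case: k => y /= /asboolP.
by exists (SubType (introT (asboolP _) Sx)).
Qed.

Definition sub_zmod := GRing.ZmodClosed.clone M (in_sub hS) _.
Definition quo_type : Type := @Quotient.quot M sub_zmod.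
HB.instance Definition _ := GRing.Zmodule.on quo_type.
HB.instance Definition _ := EqQuotient.on quo_type.
Definition quo_scale (a : R) (x : quo_type) : quo_type :=
  \pi_quo_type (a *: repr x).

Lemma quo_eq (x y : M) : \pi_quo_type x = \pi_quo_type y <-> S (x - y).

Proof.
split=> [/eqP|h].
  by rewrite -(Quotient.idealrBE sub_zmod) => /asboolP.
by apply/eqP; rewrite -(Quotient.idealrBE sub_zmod); apply/asboolP.
Qed.

Lemma quo_scaleE a x : quo_scale a (\pi_quo_type x) = \pi_quo_type (a *: x).
Proof.
apply/quo_eq; rewrite -scalerBr; case: hS => _ _; apply.
by apply/quo_eq; rewrite reprK.
Qed.

Lemma quo_surj (v : quo_type) : exists x, v = \pi_quo_type x.
Proof. by exists (repr v); rewrite reprK. Qed.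

Lemma quo_piD x y :
  \pi_quo_type (x + y) = \pi_quo_type x + \pi_quo_type y :> quo_type.
Proof. exact: (Quotient.pi_add sub_zmod). Qed.

Fact quo_scaleA a b v : quo_scale a (quo_scale b v) = quo_scale (a * b) v.
Proof. by have [x ->] := quo_surj v; rewrite !quo_scaleE scalerA. Qed.
Fact quo_scale1 : left_id 1 quo_scale.
Proof. by move=> v; have [x ->] := quo_surj v; rewrite quo_scaleE scale1r. Qed.
Fact quo_scaleDr : right_distributive quo_scale +%R.
Proof.
move=> a u v; have [x ->] := quo_surj u; have [y ->] := quo_surj v.
rewrite !quo_scaleE -quo_piD quo_scaleE scalerDr.
by rewrite quo_piD.
Qed.
Fact quo_scaleDl v : {morph quo_scale^~ v : a b / a + b}.
Proof.
move=> a b; have [x ->] := quo_surj v.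
by rewrite !quo_scaleE scalerDl quo_piD.
Qed.
HB.instance Definition _ := GRing.Zmodule_isLmodule.Build R quo_type
  quo_scaleA quo_scale1 quo_scaleDr quo_scaleDl.

Lemma pi_quo_linear : linear (\pi_quo_type : M -> quo_type).
Proof.
by move=> a x y; rewrite quo_piD -quo_scaleE.
Qed.
HB.instance Definition _ := GRing.isLinear.Build R M quo_type *:%R
  (\pi_quo_type : M -> quo_type) pi_quo_linear.

Lemma quo_exists : exists (Q : lmodType R) (f : {linear M -> Q}),
  (forall y, exists x, f x = y) /\ forall x, f x = 0 <-> S x.
Proof.
exists quo_type, (\pi_quo_type : {linear M -> quo_type}); split.
  by move=> y; have [x ->] := quo_surj y; exists x.
move=> x; rewrite -{2}[x]subr0 -quo_eq.
by rewrite -(linear0 (\pi_quo_type : {linear M -> quo_type})).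
Qed.
End SubmoduleTypes.

(** * Linear maps, short exact sequences and retracts *)

Section LinearMaps.
Variable R : comNzRingType.
Implicit Types A B C D E F K L M N P Q T W X Y Z : lmodType R.

Lemma lin_ex A B (f : A -> B) :
  linear f -> exists h : {linear A -> B}, h =1 f.
Proof.
move=> hf; pose m := GRing.isLinear.Build R A B *:%R f hf.
by exists (HB.pack_for {linear A -> B} f m).
Qed.

(** Two values related to one argument differ by a value related to 0, so the chosen function is
    forced and hence linear. Factoring through a surjection and lifting along an injection are both
    instances. *)
Lemma rel_lin A B (r : A -> B -> Prop) :
    (forall a, exists b, r a b) -> (forall b, r 0 b -> b = 0) ->
    (forall c a a' b b', r a b -> r a' b' -> r (c *: a + a') (c *: b + b')) ->
  exists h : {linear A -> B}, forall a, r a (h a).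
Proof.
move=> /choice[f hf] r0 rl.
have funr a b b' : r a b -> r a b' -> b = b'.
  move=> h h'; apply/eqP; rewrite -subr_eq0 addrC -scaleN1r; apply/eqP/r0.
  by have := rl (-1) _ _ _ _ h' h; rewrite (scaleN1r a) addNr.
have [h eh] : exists h : {linear A -> B}, h =1 f.
  by apply: lin_ex => c x y; apply: funr (hf _) _; apply: rl.
by exists h => a; rewrite eh.
Qed.

Lemma lin_factor A B C (p : {linear A -> B}) (f : {linear A -> C}) :
    (forall y, exists x, p x = y) -> (forall x, p x = 0 -> f x = 0) ->
  exists h : {linear B -> C}, forall x, h (p x) = f x.
Proof.
move=> sp kp.
have [||c b b' d d' [x [<- <-]] [x' [<- <-]]|h hh] :=
    @rel_lin B C (fun b c => exists x, p x = b /\ f x = c).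
- by move=> b; have [x <-] := sp b; exists (f x), x.
- by move=> c [x [/kp -> <-]].
- by exists (c *: x + x'); rewrite !linearP.
exists h => x; have [y [e <-]] := hh (p x).
by apply/eqP; rewrite -subr_eq0; apply/eqP; rewrite -linearB; apply: kp; rewrite linearB e subrr.
Qed.

Lemma lin_lift A B C (i : {linear A -> B}) (f : {linear C -> B}) :
    injective i -> (forall c, exists a, i a = f c) ->
  exists h : {linear C -> A}, forall c, i (h c) = f c.
Proof.
move=> ii hf; apply: (@rel_lin C A (fun c a => i a = f c)) => //.
  by move=> b; rewrite linear0 => e; apply: ii; rewrite e linear0.
by move=> c a a' b b' e e'; rewrite !linearP e e'.
Qed.

Lemma short_exactP A B C (f : {linear A -> B}) (g : {linear B -> C}) :
  short_exact f g <->
  [/\ injective f, forall y, g y = 0 <-> exists x, f x = y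
    & forall z, exists y, g y = z].
Proof.
split=> -[fi fg gs]; split=> //.
- move=> y; have := congr1 (fun S : set B => S y) fg; rewrite /= => <-.
  by split=> [[x _ <-]|[x <-]]; exists x.
- move=> z; have : [set: C] z by [].
  by rewrite -gs => -[y _ <-]; exists y.
- rewrite /exact_at; apply/seteqP; split=> y /=.
    by case=> x _ <-; apply/fg; exists x.
  by move/fg => [x <-]; exists x.
- apply/seteqP; split=> // z _.
  by have [y <-] := gs z; exists y.
Qed.

Lemma ker_exists A B (g : {linear A -> B}) :
  exists K (f : {linear K -> A}),
    injective f /\ forall x, g x = 0 <-> exists k, f k = x.
Proof.
apply: (@sub_exists R A [set x | g x = 0]); split=> /=; first exact: linear0.
  by move=> x y; rewrite linearD => -> ->; rewrite addr0.
by move=> a x; rewrite linearZ => /= ->; rewrite scaler0.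
Qed.

Lemma surj_short_exact A B (g : {linear A -> B}) :
    (forall y, exists x, g x = y) ->
  exists K (f : {linear K -> A}), short_exact f g.
Proof.
move=> gs; have [K [f [fi fg]]] := ker_exists g.
by exists K, f; apply/short_exactP.
Qed.

(** Lifting against a single map: projectivity over R and over any R/I both provide it for the
    surjections at hand, so [rotate] serves all these rings at once. *)
Definition lifts_along P A B (g : {linear A -> B}) :=
  forall f : {linear P -> B}, exists h : {linear P -> A}, forall x, g (h x) = f x.

(* The pullback of E -> F <- Q is isomorphic to K * Q, because Q -> F lifts. *)
Lemma rotate K E F Z Q (f : {linear K -> E}) (g : {linear E -> F})
    (u : {linear Z -> Q}) (v : {linear Q -> F}) :
    short_exact f g -> short_exact u v -> lifts_along Q g ->
  exists (i : {linear Z -> (K * Q)%type}) (p : {linear (K * Q)%type -> E}),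
    short_exact i p.
Proof.
move=> /short_exactP[fi fg gs] /short_exactP[ui uv vs] /(_ v)[h hh].
have [w hw] : exists w : {linear Z -> K}, forall z, f (w z) = h (u z).
  apply: (lin_lift (f := h \o u)) => // z /=; apply/fg.
  by rewrite hh; apply/uv; exists z.
have [i ei] : exists i : {linear Z -> (K * Q)%type}, i =1 fun z => (- w z, u z).
  apply: lin_ex => c x y; apply: injective_projections; rewrite /= linearP //.
  by rewrite opprD scalerN.
have [p ep] : exists p : {linear (K * Q)%type -> E},
    p =1 fun x => f x.1 + h x.2.
  by apply: lin_ex => c x y /=; rewrite !linearP scalerDr addrACA.
exists i, p; apply/short_exactP; split.
- by move=> x y; rewrite !ei => -[_ /ui].
- move=> [k q]; rewrite ep /=; split=> [e|[z]].
    have [z ez] : exists z, u z = q.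
      apply/uv; rewrite -hh; have := congr1 g e; rewrite linearD linear0.
      have -> : g (f k) = 0 by apply/fg; exists k.
      by rewrite add0r.
    exists z; rewrite ei ez; congr pair; apply: fi.
    by rewrite linearN hw ez; apply/eqP; rewrite eq_sym -addr_eq0 e.
  by rewrite ei => -[<- <-]; rewrite linearN hw addNr.
- move=> x; have [q eq] := vs (g x).
  have [k ek] : exists k, f k = x - h q by apply/fg; rewrite linearB hh eq subrr.
  by exists (k, q); rewrite ep /= ek subrK.
Qed.

Lemma lin_inl M N :
  exists i : {linear M -> (M * N)%type}, i =1 fun x => (x, 0).
Proof.
apply: lin_ex => c x y; apply: injective_projections => //=.
by rewrite scaler0 addr0.
Qed.

Lemma lin_inr M N :
  exists i : {linear N -> (M * N)%type}, i =1 fun x => (0, x).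
Proof.
apply: lin_ex => c x y; apply: injective_projections => //=.
by rewrite scaler0 addr0.
Qed.

(** Direct summands in split form: composites and products need no bookkeeping of complements, and
    [retract_complement] recovers the complement as the kernel of [r]. *)
Definition retract N M :=
  exists (i : {linear N -> M}) (r : {linear M -> N}), forall x, r (i x) = x.

Lemma retract_refl M : retract M M.
Proof. by exists idfun, idfun. Qed.

Lemma retract_trans N M E : retract N M -> retract M E -> retract N E.
Proof.
move=> [i [r ri]] [i' [r' ri']]; exists (i' \o i), (r \o r') => x /=.
by rewrite ri' ri.
Qed.

Lemma retract_fst M N : retract M (M * N)%type.
Proof.
have [i ei] := lin_inl M N.
by exists i, fst => x; rewrite ei.
Qed.

Lemma retract_snd M N : retract N (M * N)%type.
Proof.
have [i ei] := lin_inr M N.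
by exists i, snd => x; rewrite ei.
Qed.

Lemma lin_prod A A' B B' (f : {linear A -> A'}) (g : {linear B -> B'}) :
  exists h : {linear (A * B)%type -> (A' * B')%type},
    h =1 fun x => (f x.1, g x.2).
Proof.
apply: lin_ex => c x y; apply: injective_projections => /=; exact: linearP.
Qed.

Lemma retract_prod A A' B B' :
  retract A A' -> retract B B' -> retract (A * B)%type (A' * B')%type.
Proof.
move=> [i [r ri]] [i' [r' ri']].
have [f ef] := lin_prod i i'; have [g eg] := lin_prod r r'.
by exists f, g => -[x y]; rewrite ef eg /= ri ri'.
Qed.

Lemma short_exact_prod A B C A' B' C' (f : {linear A -> B})
    (g : {linear B -> C}) (f' : {linear A' -> B'}) (g' : {linear B' -> C'}) :
    short_exact f g -> short_exact f' g' ->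
  exists (i : {linear (A * A')%type -> (B * B')%type})
         (p : {linear (B * B')%type -> (C * C')%type}), short_exact i p.
Proof.
move=> /short_exactP[fi fg gs] /short_exactP[fi' fg' gs'].
have [i ei] := lin_prod f f'; have [p ep] := lin_prod g g'.
exists i, p; apply/short_exactP; split.
- by move=> [x x'] [y y']; rewrite !ei /= => -[/fi -> /fi' ->].
- move=> [x y]; rewrite ep /=; split=> [[/fg[u <-] /fg'[v <-]]|[[u v]]].
    by exists (u, v); rewrite ei.
  rewrite ei /= => -[<- <-]; congr pair.
    by apply/fg; exists u.
  by apply/fg'; exists v.
- move=> [x y]; have [u <-] := gs x; have [v <-] := gs' y.
  by exists (u, v); rewrite ep.
Qed.

Lemma bij_linear A B (f : {linear A -> B}) :
    injective f -> (forall y, exists x, f x = y) ->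
  exists g : {linear B -> A}, cancel f g /\ cancel g f.
Proof.
move=> fi fs; have [g hg] := lin_lift (f := idfun) fi fs.
by exists g; split=> x; last exact: hg; apply: fi; rewrite hg.
Qed.

Lemma iso_inverse M N (f : {linear M -> N}) : bijective f ->
  exists g : {linear N -> M}, cancel f g /\ cancel g f.
Proof.
move=> fb; apply: bij_linear; first exact: bij_inj.
by move=> y; case: fb => h _ hf; exists (h y).
Qed.

Lemma iso_sym M N : iso M N -> iso N M.
Proof. by move=> [f /iso_inverse[g [fg gf]]]; exists g, f. Qed.

Lemma iso_retract M N : iso M N -> retract M N.
Proof. by move=> [f /iso_inverse[g [fg gf]]]; exists f, g. Qed.

Lemma iso_refl M : iso M M.
Proof. by exists idfun, idfun. Qed.

Lemma retract_complement N M : retract N M -> exists W, iso (N * W)%type M.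
Proof.
move=> [i [r ri]]; have [W [f [fi fr]]] := ker_exists r.
have [p ep] : exists p : {linear (N * W)%type -> M}, p =1 fun x => i x.1 + f x.2.
  by apply: lin_ex => c x y /=; rewrite !linearP scalerDr addrACA.
have rf k : r (f k) = 0 by apply/fr; exists k.
exists W, p; have [|y|g [pg gp]] := @bij_linear _ _ p; last by exists g.
  move=> [x u] [y v]; rewrite !ep /= => e.
  have exy : x = y by have := congr1 r e; rewrite !linearD !rf !ri !addr0.
  by move: e; rewrite exy => /addrI/fi ->.
have [k ek] : exists k, f k = y - i (r y) by apply/fr; rewrite linearB ri subrr.
by exists (r y, k); rewrite ep /= ek addrC subrK.
Qed.

End LinearMaps.

(** * Finitely generated modules and the noetherian condition *)

Section FiniteGeneration.
Variable R : comNzRingType.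
Implicit Types A B C D E F K L M N P Q T W X Y Z : lmodType R.

(** Generators are peeled off one at a time, which is the shape of the induction in
    [noetherian_spans]. *)
Fixpoint spans M (l : seq M) (x : M) : Prop :=
  if l is v :: l' then exists a, spans l' (x - a *: v) else x = 0.

Lemma spans_submod M (l : seq M) : submod_set (spans l).
Proof.
elim: l => [|v l [h0 hD hZ]] /=.
  by split=> // [x y -> ->|a x ->]; rewrite ?addr0 ?scaler0.
split.
- by exists 0; rewrite scale0r subr0.
- move=> x y [a ha] [b hb]; exists (a + b).
  by rewrite scalerDl opprD addrACA; apply: hD.
- by move=> c x [a ha]; exists (c * a); rewrite -scalerA -scalerBr; apply: hZ.
Qed.

Lemma spans0 M (l : seq M) : spans l 0.
Proof. by case: (spans_submod l). Qed.
Lemma spansD M (l : seq M) x y : spans l x -> spans l y -> spans l (x + y).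
Proof. by case: (spans_submod l) => _ h _; apply: h. Qed.
Lemma spansZ M (l : seq M) a x : spans l x -> spans l (a *: x).
Proof. by case: (spans_submod l) => _ _; apply. Qed.
Lemma spansB M (l : seq M) x y : spans l x -> spans l y -> spans l (x - y).
Proof.
by move=> hx hy; apply: spansD => //; rewrite -scaleN1r; apply: spansZ.
Qed.

Lemma spans_sum M (l : seq M) (I : Type) (s : seq I) (c : I -> R) (g : I -> M) :
  (forall i, spans l (g i)) -> spans l (\sum_(i <- s) c i *: g i).
Proof.
move=> h; elim: s => [|i s IH]; first by rewrite big_nil; apply: spans0.
by rewrite big_cons; apply: spansD => //; apply: spansZ.
Qed.

Lemma spans_head M v (l : seq M) : spans (v :: l) v.
Proof. by exists 1; rewrite scale1r subrr; apply: spans0. Qed.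

Lemma spans_mem M (l : seq M) x : x \in l -> spans l x.
Proof.
elim: l => // v l IH; rewrite inE => /orP[/eqP->|/IH h]; first exact: spans_head.
by exists 0; rewrite scale0r subr0.
Qed.

Lemma spans_min M (l : seq M) (S : set M) :
  submod_set S -> (forall v, v \in l -> S v) -> forall x, spans l x -> S x.
Proof.
move=> [S0 SD SZ]; elim: l => [|v l IH] h x /=; first by move=> ->.
case=> a ha; rewrite -(subrK (a *: v) x); apply: SD.
  by apply: IH => // w hw; apply: h; rewrite inE hw orbT.
by apply: SZ; apply: h; rewrite mem_head.
Qed.

Lemma spans_sub M (l l' : seq M) :
  {subset l <= l'} -> forall x, spans l x -> spans l' x.
Proof.
by move=> h; apply: spans_min; [apply: spans_submod | move=> v /h/spans_mem].
Qed.

Lemma spans_image M N (f : {linear M -> N}) (l : seq M) x :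
  spans l x -> spans (map f l) (f x).
Proof.
elim: l x => [|v l IH] x /=; first by move=> ->; rewrite linear0.
by case=> a /IH; rewrite linearB linearZ => h; exists a.
Qed.

Lemma spans_preimage M N (f : {linear M -> N}) (l : seq M) y :
  spans (map f l) y -> exists2 x, spans l x & f x = y.
Proof.
elim: l y => [|v l IH] y /=; first by move=> ->; exists 0; rewrite ?linear0.
case=> a /IH[x hx e]; exists (x + a *: v); first by exists a; rewrite addrK.
by rewrite linearD linearZ /= e subrK.
Qed.

Lemma spans_coef M (l : seq M) x :
  spans l x -> exists c : nat -> R, x = \sum_(i < size l) c i *: l`_i.
Proof.
elim: l x => [|v l IH] x /=; first by exists (fun=> 0); rewrite big_ord0.
case=> a /IH[c e]; exists (fun i => if i is j.+1 then c j else a).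
by rewrite big_ord_recl /= -e addrC subrK.
Qed.

Lemma fin_genP M : fin_gen M <-> exists l : seq M, forall x, spans l x.
Proof.
split=> [[n [g hg]]|[l hl]].
  exists [seq g i | i <- enum 'I_n] => x; have [c ->] := hg x.
  by apply: spans_sum => i; apply/spans_mem/map_f; rewrite mem_enum.
exists (size l), (fun i => l`_i) => x; have [c ->] := spans_coef (hl x).
by exists (fun i => c i).
Qed.

Lemma fin_gen_image M N (f : {linear M -> N}) :
  (forall y, exists x, f x = y) -> fin_gen M -> fin_gen N.
Proof.
move=> fs /fin_genP[l hl]; apply/fin_genP; exists (map f l) => y.
by have [x <-] := fs y; apply: spans_image.
Qed.

Lemma fin_gen_retract M N : retract N M -> fin_gen M -> fin_gen N.
Proof.
by move=> [i [r ri]]; apply: (fin_gen_image (f := r)) => y; exists (i y).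
Qed.

Lemma fin_gen_ext A B C (f : {linear A -> B}) (g : {linear B -> C}) :
  short_exact f g -> fin_gen A -> fin_gen C -> fin_gen B.
Proof.
move=> /short_exactP[fi fg gs] /fin_genP[l hl] /fin_genP[m hm].
have [s hs] := choice gs.
have em : m = map g (map s m).
  by rewrite -map_comp -[LHS]map_id; apply: eq_map => z /=; rewrite hs.
apply/fin_genP; exists (map f l ++ map s m) => y.
have [y' hy' e] : exists2 y', spans (map s m) y' & g y' = g y.
  by apply: spans_preimage; rewrite -em.
have [x ex] : exists x, f x = y - y' by apply/fg; rewrite linearB e subrr.
rewrite -(subrK y' y) -ex; apply: spansD.
  by apply: (spans_sub (l := map f l)); [move=> v; rewrite mem_cat => ->
    | apply: spans_image].
by apply: spans_sub hy' => v hv; rewrite mem_cat hv orbT.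
Qed.

Lemma short_exact_pair M N :
  exists (f : {linear M -> (M * N)%type}) (g : {linear (M * N)%type -> N}),
    short_exact f g.
Proof.
have [i ei] := lin_inl M N.
exists i, snd; apply/short_exactP; split.
- by move=> x y; rewrite !ei => -[].
- move=> [x y] /=; split=> [->|[z]]; first by exists x; rewrite ei.
  by rewrite ei => -[].
- by move=> z; exists (0, z).
Qed.

Lemma fin_gen_prod M N : fin_gen M -> fin_gen N -> fin_gen (M * N)%type.
Proof.
by move=> hM hN; have [f [g e]] := short_exact_pair M N; apply: fin_gen_ext e _ _.
Qed.

Lemma is_ideal_submod (I : set R) : is_ideal I <-> @submod_set R R^o I.
Proof. by split=> -[h0 hD hZ]; split. Qed.

Hypothesis hR : noetherian R.

(** The possible coefficients of [v] in elements of [S] form an ideal [J]. Lifts to [S] of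
    generators of [J], together with generators of the part of [S] inside the span of [l], generate
    [S]. *)
Lemma noetherian_spans M (l : seq M) (S : set M) :
    submod_set S -> (forall x, S x -> spans l x) ->
  exists l', forall x, S x <-> spans l' x.
Proof.
elim: l S => [|v l IH] S [S0 SD SZ] hS.
  exists [::] => x; split=> [/hS //|/= -> //].
pose J := [set a : R | exists2 x, S x & spans l (x - a *: v)].
have [|n [g eJ]] := hR (I := J).
  split.
  - by exists 0 => //; rewrite scale0r subr0; apply: spans0.
  - move=> a b [x Sx hx] [y Sy hy]; exists (x + y); first exact: SD.
    by rewrite scalerDl opprD addrACA; apply: spansD.
  - move=> c a [x Sx hx]; exists (c *: x); first exact: SZ.
    by rewrite -scalerA -scalerBr; apply: spansZ.
have /choice[s hs] : forall i, exists x, S x /\ spans l (x - g i *: v).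
  move=> i; have : J (g i).
    rewrite eJ; exists (fun j => (j == i)%:R).
    rewrite (bigD1 i) //= eqxx mul1r big1 ?addr0 // => j /negPf ->.
    by rewrite mul0r.
  by case=> x; exists x.
have [||m hm] := IH [set x | S x /\ spans l x]; last first.
- exists (map s (enum 'I_n) ++ m) => x; split=> [Sx|]; last first.
    apply: spans_min; first by split.
    move=> w; rewrite mem_cat => /orP[/mapP[i _ ->]|/spans_mem/hm[]//].
    by case: (hs i).
  have [a ha] := hS _ Sx.
  have : J a by exists x.
  rewrite eJ => -[c ea].
  pose y := \sum_(i < n) c i *: s i.
  have Sy : S y by apply: (big_rec S) => // i z _ Sz; apply: SD => //; apply: SZ; case: (hs i).
  rewrite -(subrK y x); apply: spansD.
    apply: (spans_sub (l := m)); first by move=> w; rewrite mem_cat orbC => ->.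
    apply/hm; split; first by apply: SD => //; rewrite -scaleN1r; apply: SZ.
    have -> : x - y = (x - a *: v) - (y - a *: v) by rewrite opprB addrA subrK.
    apply: spansB => //.
    have -> : y - a *: v = \sum_(i < n) c i *: (s i - g i *: v).
      rewrite ea scaler_suml -sumrB; apply: eq_bigr => i _.
      by rewrite scalerBr scalerA.
    by apply: spans_sum => i; case: (hs i).
  apply: (spans_sub (l := map s (enum 'I_n))).
    by move=> w; rewrite mem_cat => ->.
  by apply: spans_sum => i; apply/spans_mem/map_f; rewrite mem_enum.
- by move=> x [].
- split=> [|x y [Sx hx] [Sy hy]|a x [Sx hx]]; split=> //.
  + exact: spans0.
  + exact: SD.
  + exact: spansD.
  + exact: SZ.
  + exact: spansZ.
Qed.

Lemma fin_gen_sub M N (f : {linear N -> M}) :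
  injective f -> fin_gen M -> fin_gen N.
Proof.
move=> fi /fin_genP[l hl].
have [||m hm] := @noetherian_spans M l [set x | exists y, f y = x] => //.
  split=> /=; first by exists 0; rewrite linear0.
    by move=> x y [u <-] [v <-]; exists (u + v); rewrite linearD.
  by move=> a x [u <-]; exists (a *: u); rewrite linearZ.
have /choice[s hs] : forall x, exists y, x \in m -> f y = x.
  move=> x; have [hx|] := boolP (x \in m); last by exists 0.
  by have [y <-] := (hm x).2 (spans_mem hx); exists y.
have em : m = map f (map s m).
  by rewrite -map_comp -[LHS]map_id; apply/eq_in_map => x hx /=; rewrite hs.
apply/fin_genP; exists (map s m) => y.
have /hm : exists z, f z = f y by exists y.
by rewrite {1}em => /spans_preimage[z hz /fi <-].
Qed.

End FiniteGeneration.

(** * Modules built from one module *)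

Section Reach.
Variable R : comNzRingType.
Implicit Types A B C E F G K L M N P Q T W X Y Z : lmodType R.
Implicit Types (m n : nat) (CC DD : lmodType R -> Prop).

(** Iterated products stand in for the finite functions of [add_mod], so that facts about powers
    follow from facts about binary products; [retract_pow_ffun] leads back. *)
Fixpoint pow G m : lmodType R :=
  if m is k.+1 then (G * pow G k)%type else 'rV[R]_0.

Definition zero_mod M := forall x : M, x = 0.

Lemma zero_pow0 G : zero_mod (pow G 0).
Proof. by move=> x; apply: thinmx0. Qed.

Lemma lin_zero M N : exists f : {linear M -> N}, f =1 fun=> 0.
Proof. by apply: lin_ex => c x y; rewrite scaler0 addr0. Qed.

Lemma short_exact_0l Z M : zero_mod Z ->
  exists (f : {linear Z -> M}) (g : {linear M -> M}), short_exact f g.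
Proof.
move=> hZ; have [f ef] := lin_zero Z M; exists f, idfun.
apply/short_exactP; split.
- by move=> x y _; rewrite (hZ x) (hZ y).
- by move=> y; split=> /= [->|[x <-]]; [exists 0; rewrite linear0 | rewrite ef].
- by move=> z; exists z.
Qed.

Lemma short_exact_0r Z M : zero_mod Z ->
  exists (f : {linear M -> M}) (g : {linear M -> Z}), short_exact f g.
Proof.
move=> hZ; have [f ef] := lin_zero M Z; exists idfun, f.
apply/short_exactP; split => //.
- by move=> y; split=> // _; exists y.
- by move=> z; exists 0; rewrite ef -(hZ z).
Qed.

Lemma retract_zero N M : retract N M -> zero_mod M -> zero_mod N.
Proof. by move=> [i [r ri]] h x; rewrite -[x]ri (h (i x)) linear0. Qed.

Lemma zero_retract N M : zero_mod N -> retract N M.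
Proof.
move=> hN; have [i _] := lin_zero N M; have [r _] := lin_zero M N.
by exists i, r => x; rewrite [x]hN linear0 linear0.
Qed.

(** Adding the complement of [C] in [E] to both [M] and [C] leaves the kernel [A] unchanged and
    keeps [M] a retract of the middle term. A quotient known only up to retracts can thus be
    replaced by one that carries a filtration. *)
Lemma short_exact_retract A M C E (f : {linear A -> M}) (g : {linear M -> C}) :
    short_exact f g -> retract C E ->
  exists N (u : {linear A -> N}) (v : {linear N -> E}),
    retract M N /\ short_exact u v.
Proof.
move=> /short_exactP[fi fg gs] /retract_complement[W [p [p' pK p'K]]].
have [u eu] : exists u : {linear A -> (M * W)%type}, u =1 fun a => (f a, 0).
  apply: lin_ex => c x y; apply: injective_projections => /=.
    by rewrite linearP.
  by rewrite scaler0 addr0.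
have [q eq] := lin_prod g (idfun : {linear W -> W}).
exists (M * W)%type, u, (p \o q); split; first exact: retract_fst.
apply/short_exactP; split.
- by move=> x y; rewrite !eu => -[/fi].
- move=> [x w] /=; rewrite eq /=; split=> [|[a]].
    rewrite -(linear0 p) => /(can_inj pK)[/fg[a <-] ->].
    by exists a; rewrite eu.
  rewrite eu => -[<- <-].
  have -> : g (f a) = 0 by apply/fg; exists a.
  exact: linear0.
- move=> z; have [x ex] := gs (p' z).1.
  by exists (x, (p' z).2); rewrite /= eq /= ex -surjective_pairing.
Qed.

(** [K] is the preimage of [Y] in [N]: a filtration of the quotient [E] pulls back to [N]. This
    reassociates extensions in [reach_ext] and compares covers in [rsyz_ext]. *)
Lemma short_exact_pullback A N E Y X (f : {linear A -> N}) (q : {linear N -> E})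
    (u : {linear Y -> E}) (v : {linear E -> X}) :
    short_exact f q -> short_exact u v ->
  exists K (a : {linear A -> K}) (b : {linear K -> Y}) (j : {linear K -> N})
    (w : {linear N -> X}), [/\ short_exact a b, short_exact j w & w = v \o q].
Proof.
move=> /short_exactP[fi fq qs] /short_exactP[ui uv vs].
have [K [j [ji jv]]] := ker_exists (v \o q).
have [b hb] : exists b : {linear K -> Y}, forall k, u (b k) = q (j k).
  by apply: (lin_lift (f := q \o j)) => // k; apply/uv; apply/jv; exists k.
have [a ha] : exists a : {linear A -> K}, forall x, j (a x) = f x.
  apply: lin_lift => // x; apply/jv => /=.
  have -> : q (f x) = 0 by apply/fq; exists x.
  exact: linear0.
exists K, a, b, j, (v \o q); split=> //; apply/short_exactP; split=> //.
- by move=> x y e; apply: fi; rewrite -!ha e.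
- move=> k; split=> [e|[x <-]].
    have [x ex] : exists x, f x = j k by apply/fq; rewrite -hb e linear0.
    by exists x; apply: ji; rewrite ha.
  by apply: ui; rewrite hb ha linear0; apply/fq; exists x.
- move=> y; have [x ex] := qs (u y).
  have [k ek] : exists k, j k = x by apply/jv; rewrite /= ex; apply/uv; exists y.
  by exists k; apply: ui; rewrite hb ek.
- by move=> z; have [y <-] := vs z; have [x <-] := qs y; exists x.
Qed.

Definition radd G X := exists m, retract X (pow G m).

(* [reach G n] is [ball G n] with direct summands presented by retractions. *)
Fixpoint reach G n M : Prop :=
  if n is k.+1 then
    exists E Y X (f : {linear Y -> E}) (g : {linear E -> X}),
      [/\ retract M E, reach G k Y, radd G X & short_exact f g]
  else zero_mod M.

Lemma radd_zero G M : zero_mod M -> radd G M.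
Proof. by move=> hM; exists 0; apply: zero_retract. Qed.

Lemma reachS G n M : reach G n M -> reach G n.+1 M.
Proof.
move=> h; have h0 := @zero_pow0 G.
have [f [g e]] := short_exact_0r M h0.
by exists M, M, _, f, g; split=> //; [apply: retract_refl | apply: radd_zero].
Qed.

Lemma reach_retract G n N M : retract N M -> reach G n M -> reach G n N.
Proof.
case: n => [|n] rN; first exact: retract_zero.
move=> [E [Y [X [f [g [rM hY hX e]]]]]].
by exists E, Y, X, f, g; split=> //; apply: retract_trans rM.
Qed.

(** Induction on the layers of [C]: its top layer becomes the top layer of [M] up to a retract, and
    the preimage of the remaining layers is again an extension by [A]. *)
Lemma reach_ext G A M C m n (f : {linear A -> M}) (g : {linear M -> C}) :
  short_exact f g -> reach G m A -> reach G n C -> reach G (n + m) M.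
Proof.
elim: n M C f g => [|n IH] M C f g e hA.
  move=> hC; apply: reach_retract hA.
  have [fi fg _] := (short_exactP f g).1 e.
  have [|h [_ fh]] := bij_linear fi; last by exists h, f.
  by move=> y; apply/fg; rewrite [LHS]hC.
move=> [E [Y [X [u [v [rC hY hX e']]]]]].
have [N [u' [q [rM e1]]]] := short_exact_retract e rC.
have [K [a [b [j [w [e2 e3 _]]]]]] := short_exact_pullback e1 e'.
by exists N, K, X, j, w; split=> //; apply: IH e2 hA hY.
Qed.

Lemma retract_pow G G' m : retract G G' -> retract (pow G m) (pow G' m).
Proof.
move=> h; elim: m => [|m IH]; first exact: retract_refl.
exact: retract_prod.
Qed.

Lemma reach_gen G G' n M : retract G G' -> reach G n M -> reach G' n M.
Proof.
move=> h; elim: n M => //= n IH M [E [Y [X [f [g [rM hY [m hX] e]]]]]].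
exists E, Y, X, f, g; split=> //; first exact: IH.
by exists m; apply: retract_trans hX _; apply: retract_pow.
Qed.

Lemma reach_radd G X : radd G X -> reach G 1 X.
Proof.
have h0 := @zero_pow0 G; have [f [g e]] := short_exact_0l X h0.
by exists X, _, X, f, g; split=> //; apply: retract_refl.
Qed.

Lemma fin_gen_zero M : zero_mod M -> fin_gen M.
Proof. by move=> h; apply/fin_genP; exists [::]. Qed.

Lemma fin_gen_pow G m : fin_gen G -> fin_gen (pow G m).
Proof.
move=> h; elim: m => [|m IH]; last exact: fin_gen_prod.
by apply: fin_gen_zero; apply: zero_pow0.
Qed.

Lemma fin_gen_radd G X : fin_gen G -> radd G X -> fin_gen X.
Proof. by move=> h [m /fin_gen_retract]; apply; apply: fin_gen_pow. Qed.

Lemma fin_gen_reach G n M : fin_gen G -> reach G n M -> fin_gen M.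
Proof.
move=> hG; elim: n M => [|n IH] M; first exact: fin_gen_zero.
move=> [E [Y [X [f [g [rM /IH hY /(fin_gen_radd hG) hX e]]]]]].
by apply: fin_gen_retract rM _; apply: fin_gen_ext e _ _.
Qed.

Definition bounded CC :=
  exists G n, fin_gen G /\ forall M, CC M -> reach G n M.

Lemma bounded_sub CC DD :
  (forall M, CC M -> DD M) -> bounded DD -> bounded CC.
Proof. by move=> h [G [n [hG hn]]]; exists G, n; split=> // M /h/hn. Qed.

Lemma bounded_zero : bounded zero_mod.
Proof.
exists (pow R^o 0), 0; split=> //.
by apply: fin_gen_zero; apply: (@zero_pow0 R^o).
Qed.

Lemma bounded_radd G : fin_gen G -> bounded (radd G).
Proof. by move=> h; exists G, 1; split=> // M /reach_radd. Qed.

Lemma bounded_ext CC (D1 D2 : lmodType R -> Prop) :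
    (forall M, CC M -> exists A C E (f : {linear A -> E}) (g : {linear E -> C}),
       [/\ D1 A, D2 C, short_exact f g & retract M E]) ->
  bounded D1 -> bounded D2 -> bounded CC.
Proof.
move=> h [G1 [n1 [hG1 h1]]] [G2 [n2 [hG2 h2]]].
exists (G1 * G2)%type, (n2 + n1); split; first exact: fin_gen_prod.
move=> M /h[A [C [E [f [g [/h1 hA /h2 hC e rM]]]]]].
apply: reach_retract rM _; apply: reach_ext e _ _.
  exact: reach_gen (retract_fst _ _) hA.
exact: reach_gen (retract_snd _ _) hC.
Qed.

Lemma bounded_prod (D1 D2 : lmodType R -> Prop) : bounded D1 -> bounded D2 ->
  bounded (fun M => exists A C, [/\ D1 A, D2 C & retract M (A * C)%type]).
Proof.
apply: bounded_ext => M [A [C [hA hC rM]]].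
have [f [g e]] := short_exact_pair A C.
by exists A, C, (A * C)%type, f, g.
Qed.

End Reach.

(** * Syzygies over quotient rings *)

Section RelativeSyzygies.
Variable R : comNzRingType.
Implicit Types A B C E F G K L M N P Q T W X Y Z : lmodType R.
Implicit Types (m n : nat) (CC DD : lmodType R -> Prop) (I J : set R).

Definition killed I M := forall a (x : M), I a -> a *: x = 0.

(** For an ideal [I] these are the finitely generated projective R/I-modules: R-modules killed by
    [I] are the R/I-modules, with the same linear maps. *)
Definition rproj I P :=
  [/\ fin_gen P, killed I P
    & forall A B (g : {linear A -> B}), killed I A -> killed I B ->
        (forall y, exists x, g x = y) -> lifts_along P g].

(* Syzygies over R/I, expressed by R-modules that are killed by I. *)
Definition rsyz1 I M K :=
  exists P (f : {linear K -> P}) (g : {linear P -> M}),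
    rproj I P /\ short_exact f g.

Fixpoint rsyz I k M K : Prop :=
  if k is j.+1 then exists2 L, rsyz I j M L & rsyz1 I L K else iso M K.

Lemma killed_inj I M N (f : {linear M -> N}) :
  injective f -> killed I N -> killed I M.
Proof. by move=> fi h a x Ia; apply: fi; rewrite linearZ linear0 /= h. Qed.

Lemma killed_retract I M N : retract M N -> killed I N -> killed I M.
Proof. by move=> [i [r ri]]; apply: (killed_inj (f := i)); apply: can_inj ri. Qed.

Lemma killed_prod I M N : killed I M -> killed I N -> killed I (M * N)%type.
Proof.
move=> hM hN a [x y] Ia; apply: injective_projections => /=.
  exact: hM.
exact: hN.
Qed.

Lemma killed_subset I J M : (forall a, I a -> J a) -> killed J M -> killed I M.
Proof. by move=> h hM a x /h; apply: hM. Qed.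

Lemma killed_zero I M : zero_mod M -> killed I M.
Proof. by move=> h a x _; apply: h. Qed.

Lemma killed_pow I G m : killed I G -> killed I (pow G m).
Proof.
move=> h; elim: m => [|m IH]; last exact: killed_prod.
by apply: killed_zero; apply: zero_pow0.
Qed.

Lemma rproj_zero I P : zero_mod P -> rproj I P.
Proof.
move=> h; split; [exact: fin_gen_zero | exact: killed_zero |].
move=> A B g _ _ gs f; have [z ez] := lin_zero P A; exists z => x.
by rewrite ez linear0 [x]h linear0.
Qed.

Lemma rproj_prod I P Q : rproj I P -> rproj I Q -> rproj I (P * Q)%type.
Proof.
move=> [fP kP lP] [fQ kQ lQ]; split; [exact: fin_gen_prod|exact: killed_prod|].
move=> A B g kA kB gs f.
have [i ei] := lin_inl P Q.
have [j ej] := lin_inr P Q.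
have [u hu] := lP _ _ g kA kB gs (f \o i).
have [v hv] := lQ _ _ g kA kB gs (f \o j).
have [h eh] : exists h : {linear (P * Q)%type -> A}, h =1 fun x => u x.1 + v x.2.
  by apply: lin_ex => c x y /=; rewrite !linearP scalerDr addrACA.
exists h => -[x y]; rewrite eh /= linearD hu hv /= -linearD ei ej.
by congr (f _); apply: injective_projections; rewrite /= ?addr0 ?add0r.
Qed.

Lemma rproj_pow I P m : rproj I P -> rproj I (pow P m).
Proof.
move=> h; elim: m => [|m IH]; last exact: rproj_prod.
by apply: rproj_zero; apply: zero_pow0.
Qed.

Definition cyclic_quotient I Q (p : {linear R^o -> Q}) :=
  (forall y, exists x, p x = y) /\ forall x, p x = 0 <-> I x.

Lemma cyclic_exists I : is_ideal I ->
  exists Q (p : {linear R^o -> Q}), cyclic_quotient I p.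
Proof.
by move=> /is_ideal_submod/quo_exists[Q [p [ps pk]]]; exists Q, p; split.
Qed.

Lemma lin_point M (x : M) :
  exists f : {linear R^o -> M}, f =1 fun a => a *: x.
Proof. by apply: lin_ex => c a b; rewrite scalerDl scalerA. Qed.

Lemma cyclic_point I Q (p : {linear R^o -> Q}) M (x : M) :
    cyclic_quotient I p -> killed I M ->
  exists f : {linear Q -> M}, forall a, f (p a) = a *: x.
Proof.
move=> [ps pk] kM; have [g eg] := lin_point x.
have [|f hf] := lin_factor (f := g) ps.
  by move=> a /pk Ia; rewrite eg kM.
by exists f => a; rewrite hf eg.
Qed.

Lemma rproj_cyclic I Q (p : {linear R^o -> Q}) :
  is_ideal I -> cyclic_quotient I p -> rproj I Q.
Proof.
move=> [_ _ hI] hp; have [ps pk] := hp; split.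
- apply/fin_genP; exists [:: p 1] => y; have [x <-] := ps y; exists x => /=.
  by rewrite -linearZ /= -linearB /= [_ *: _]mulr1 subrr linear0.
- move=> a y Ia; have [x <-] := ps y; rewrite -linearZ; apply/pk => /=.
  by rewrite [_ *: _]mulrC; apply: hI.
- move=> A B g kA kB gs f; have [x ex] := gs (f (p 1)).
  have [h hh] := cyclic_point x hp kA; exists h => y; have [a <-] := ps y.
  by rewrite hh linearZ /= ex -linearZ /= -linearZ /= [_ *: _]mulr1.
Qed.

Lemma cyclic_cover I Q (p : {linear R^o -> Q}) M :
    cyclic_quotient I p -> killed I M -> forall l : seq M,
  exists g : {linear pow Q (size l) -> M},
    forall x, spans l x -> exists y, g y = x.
Proof.
move=> hp kM; elim=> [|v l [g hg]].
  have [z ez] := lin_zero (pow Q 0) M.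
  by exists z => x /= ->; exists 0; rewrite linear0.
have [h hh] := cyclic_point v hp kM.
have [w ew] : exists w : {linear pow Q (size (v :: l)) -> M},
    w =1 fun x => h x.1 + g x.2.
  by apply: lin_ex => c x y /=; rewrite !linearP scalerDr addrACA.
exists w => x /= [a /hg[y ey]]; exists (p a, y).
by rewrite ew /= hh ey addrC subrK.
Qed.

Lemma cover_exists I Q (p : {linear R^o -> Q}) M :
    cyclic_quotient I p -> killed I M -> fin_gen M ->
  exists m (g : {linear pow Q m -> M}), forall y, exists x, g x = y.
Proof.
move=> hp kM /fin_genP[l hl]; have [g hg] := cyclic_cover hp kM l.
by exists (size l), g => y; apply: hg.
Qed.

Lemma rproj_radd I Q (p : {linear R^o -> Q}) P :
  is_ideal I -> cyclic_quotient I p -> rproj I P -> radd Q P.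
Proof.
move=> hI hp [fP kP lP]; have [_ kQ _] := rproj_cyclic hI hp.
have [m [g gs]] := cover_exists hp kP fP; exists m.
have [h hh] := lP _ _ g (killed_pow kQ) kP gs idfun.
by exists h, g.
Qed.

Lemma bounded_rproj I : is_ideal I -> bounded (rproj I).
Proof.
move=> hI; have [Q [p hp]] := cyclic_exists hI.
apply: (bounded_sub (DD := radd Q)) => [P|]; first exact: rproj_radd hp.
by apply: bounded_radd; case: (rproj_cyclic hI hp).
Qed.

(* Schanuel's lemma, for a retract. *)
Lemma retract_syzygy I M E K K' : killed I M -> killed I E ->
    retract M E -> rsyz1 I M K -> rsyz1 I E K' ->
  exists2 P, rproj I P & retract K (K' * P)%type.
Proof.
move=> kM kE [i [r ri]] [P [f [g [hP /short_exactP[fi fg gs]]]]].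
move=> [P' [f' [g' [hP' /short_exactP[fi' fg' gs']]]]].
have gf k : g (f k) = 0 by apply/fg; exists k.
have gf' k : g' (f' k) = 0 by apply/fg'; exists k.
have [_ kP lP] := hP; have [_ kP' lP'] := hP'.
have [s hs] := lP _ _ g' kP' kE gs' (i \o g).
have [t ht] := lP' _ _ g kP kM gs (r \o g').
rewrite /= in hs ht.
have [u hu] : exists u : {linear K -> K'}, forall k, f' (u k) = s (f k).
  apply: (lin_lift (f := s \o f)) => // k /=; apply/fg'.
  by rewrite hs gf linear0.
have [v hv] : exists v : {linear K' -> K}, forall k, f (v k) = t (f' k).
  apply: (lin_lift (f := t \o f')) => // k /=; apply/fg.
  by rewrite ht gf' linear0.
(* As [r] inverts [i], one has g t s = g. So t s - 1 takes values in [K], and its lift [h] corrects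
   v u to the identity of [K]. *)
have [d ed] : exists d : {linear P -> P}, d =1 fun x => t (s x) - x.
  by apply: lin_ex => c x y; rewrite !linearP scalerDr addrACA.
have [h hh] : exists h : {linear P -> K}, forall x, f (h x) = d x.
  apply: lin_lift => // x; apply/fg.
  by rewrite ed linearB ht hs ri subrr.
have [j ej] : exists j : {linear K -> (K' * P)%type}, j =1 fun x => (u x, f x).
  by apply: lin_ex => c x y; apply: injective_projections; rewrite /= linearP.
have [q eq] : exists q : {linear (K' * P)%type -> K},
    q =1 fun x => v x.1 - h x.2.
  by apply: lin_ex => c x y /=; rewrite !linearP scalerDr addrACA.
exists P => //; exists j, q => k; rewrite ej eq /=; apply: fi.
by rewrite linearB hv hu hh ed opprB addrC subrK.
Qed.

Lemma killed_rsyz1 I M K : rsyz1 I M K -> killed I K.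
Proof.
by move=> [P [f [g [[_ kP _] [fi _ _]]]]]; apply: killed_inj fi kP.
Qed.

Lemma killed_rsyz I k M K : killed I M -> rsyz I k M K -> killed I K.
Proof.
case: k => [|k] kM; last by move=> [L _ /killed_rsyz1].
by move=> /iso_sym/iso_retract/killed_retract; apply.
Qed.

Lemma rsyz1_isol I M M' K : iso M M' -> rsyz1 I M' K -> rsyz1 I M K.
Proof.
move=> /iso_sym[h [h' hK h'K]] [P [f [g [hP /short_exactP[fi fg gs]]]]].
exists P, f, (h \o g); split=> //; apply/short_exactP; split=> //=.
  by move=> y; rewrite -fg -{1}(linear0 h); split=> [/(can_inj hK)|->].
by move=> z; have [y ey] := gs (h' z); exists y; rewrite ey.
Qed.

Lemma rsyz1_isor I M L K : iso L K -> rsyz1 I M L -> rsyz1 I M K.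
Proof.
move=> /iso_sym[h [h' hK h'K]] [P [f [g [hP /short_exactP[fi fg gs]]]]].
exists P, (f \o h), g; split=> //; apply/short_exactP; split=> //=.
  by move=> x y /= /fi/(can_inj hK).
move=> y; rewrite fg; split=> [[x <-]|[x <-]]; last by exists (h x).
by exists (h' x); rewrite h'K.
Qed.

(** The definition splits off the last syzygy; arguments that change the module or the ring have to
    split off the first one. *)
Lemma rsyzS I k M K :
  rsyz I k.+1 M K <-> exists L, rsyz1 I M L /\ rsyz I k L K.
Proof.
elim: k K => [|k IH] K; split.
- move=> [L /rsyz1_isol h /h hK]; exists K; split=> //; exact: iso_refl.
- by move=> [L [h /rsyz1_isor hK]]; exists M; [apply: iso_refl | apply: hK].
- move=> [L /IH[L' [h1 h2]] h]; exists L'; split=> //; by exists L.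
- by move=> [L [h1 [L' h2 h3]]]; exists L' => //; apply/IH; exists L.
Qed.

Lemma rsyz1_prod I A A' B B' :
  rsyz1 I A A' -> rsyz1 I B B' -> rsyz1 I (A * B)%type (A' * B')%type.
Proof.
move=> [P [f [g [hP e]]]] [P' [f' [g' [hP' e']]]].
have [i [p ip]] := short_exact_prod e e'.
by exists (P * P')%type, i, p; split=> //; apply: rproj_prod.
Qed.

Lemma iso_prod A A' B B' : iso A A' -> iso B B' -> iso (A * B)%type (A' * B')%type.
Proof.
move=> [f [f' fK f'K]] [g [g' gK g'K]]; have [h eh] := lin_prod f g.
by exists h, (fun x => (f' x.1, g' x.2)) => -[x y]; rewrite ?eh /= ?eh /= ?fK ?gK ?f'K ?g'K.
Qed.

Lemma rsyz_prod I k A A' B B' :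
  rsyz I k A A' -> rsyz I k B B' -> rsyz I k (A * B)%type (A' * B')%type.
Proof.
elim: k A' B' => [|k IH] A' B'; first exact: iso_prod.
move=> [L /IH h h1] [L' /h h' h1']; exists (L * L')%type => //.
exact: rsyz1_prod.
Qed.

(** The split sequence 0 -> Q -> Q * Q -> Q -> 0 makes [Q] one of its own syzygies, so a projective
    factor can be carried unchanged through all orders. *)
Lemma rsyz1_rproj I Q : rproj I Q -> rsyz1 I Q Q.
Proof.
move=> h; have [f [g e]] := short_exact_pair Q Q.
by exists (Q * Q)%type, f, g; split=> //; apply: rproj_prod.
Qed.

Lemma rsyz_rproj I k Q : rproj I Q -> rsyz I k Q Q.
Proof.
move=> h; elim: k => [|k IH] /=; first exact: iso_refl.
by exists Q => //; apply: rsyz1_rproj.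
Qed.

Lemma rsyz_pow I k M K m : rsyz I k M K -> rsyz I k (pow M m) (pow K m).
Proof.
move=> h; elim: m => [|m IH]; last exact: rsyz_prod.
by apply: rsyz_rproj; apply: rproj_zero; apply: zero_pow0.
Qed.

(** Schanuel's lemma iterated: the projective factor [P] gathered so far is its own syzygy and is
    added to both [L'] and [K'] before the next application. *)
Lemma retract_rsyz I k M E K K' : killed I M -> killed I E ->
    retract M E -> rsyz I k M K -> rsyz I k E K' ->
  exists2 P, rproj I P & retract K (K' * P)%type.
Proof.
move=> kM kE rM; elim: k K K' => [|k IH] K K' /=.
  move=> /iso_sym/iso_retract h1 /iso_retract h2.
  exists (pow R^o 0); first by apply: rproj_zero; apply: (@zero_pow0 _ R^o).
  apply: retract_trans (retract_fst _ _).
  exact: retract_trans h1 (retract_trans rM h2).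
move=> [L hL hK] [L' hL' hK']; have [P hP rL] := IH _ _ hL hL'.
have kL' : killed I (L' * P)%type.
  by apply: killed_prod; [apply: killed_rsyz hL' | case: hP].
have hp := rsyz1_prod hK' (rsyz1_rproj hP).
have [P' hP' rK] := retract_syzygy (killed_rsyz kM hL) kL' rL hK hp.
exists (P * P')%type; first exact: rproj_prod.
apply: retract_trans rK _; apply: iso_retract.
have [h eh] : exists h : {linear ((K' * P) * P')%type -> (K' * (P * P'))%type},
    h =1 fun x => (x.1.1, (x.1.2, x.2)) by apply: lin_ex.
by exists h, (fun x => ((x.1, x.2.1), x.2.2)) => [[[x y] z]|[x [y z]]]; rewrite eh.
Qed.

End RelativeSyzygies.

(** * Bounded classes of syzygies: horseshoe lemma and change of rings *)

Section BoundedSyzygies.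
Variable R : comNzRingType.
Hypothesis hR : noetherian R.
Implicit Types A B C E F G K L M N P Q T W X Y Z : lmodType R.
Implicit Types (m n : nat) (CC DD : lmodType R -> Prop) (I J : set R).

Definition fgmod I M := fin_gen M /\ killed I M.

Definition syz I k CC K := exists2 M, CC M & rsyz I k M K.

Lemma fgmod_rsyz1 I M K : rsyz1 I M K -> fgmod I K.
Proof.
move=> h; split; last exact: killed_rsyz1 h.
case: h => P [f [g [[fP _ _] [fi _ _]]]]; exact: fin_gen_sub fi fP.
Qed.

Lemma fgmod_retract I M N : retract M N -> fgmod I N -> fgmod I M.
Proof.
by move=> r [fN kN]; split; [apply: fin_gen_retract r fN|apply: killed_retract r kN].
Qed.

Lemma fgmod_rsyz I k M K : fgmod I M -> rsyz I k M K -> fgmod I K.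
Proof.
case: k => [|k] hM; last by move=> [L _ /fgmod_rsyz1].
by move=> /iso_sym/iso_retract/fgmod_retract; apply.
Qed.

Lemma fgmod_rproj I P : rproj I P -> fgmod I P.
Proof. by case. Qed.

Lemma fgmod_prod I M N : fgmod I M -> fgmod I N -> fgmod I (M * N)%type.
Proof. by move=> [? ?] [? ?]; split; [apply: fin_gen_prod | apply: killed_prod]. Qed.

Lemma rsyz1_exists I M : is_ideal I -> fgmod I M -> exists K, rsyz1 I M K.
Proof.
move=> hI [fM kM]; have [Q [p hp]] := cyclic_exists hI.
have [m [g gs]] := cover_exists hp kM fM.
have [K [f e]] := surj_short_exact gs.
exists K, (pow Q m), f, g; split=> //; apply: rproj_pow.
exact: rproj_cyclic hI hp.
Qed.

Lemma rsyz_exists I k M : is_ideal I -> fgmod I M -> exists K, rsyz I k M K.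
Proof.
move=> hI hM; elim: k => [|k [L hL]]; first by exists M; apply: iso_refl.
have [K hK] := rsyz1_exists hI (fgmod_rsyz hM hL).
by exists K, L.
Qed.

(** [syz] contains every choice of syzygy. Any of them is a retract of the chosen [K] times a
    projective R/I-module, and those modules are bounded, so one choice for one [E] having [M] as a
    retract is enough. *)
Lemma bounded_syz_retract I k CC DD : is_ideal I ->
    (forall M, CC M -> exists E, [/\ fgmod I E, retract M E
        & exists2 K, rsyz I k E K & DD K]) ->
  bounded DD -> bounded (syz I k CC).
Proof.
move=> hI h bD; apply: bounded_sub (bounded_prod bD (bounded_rproj hI)).
move=> K [M /h[E [hE rM [K' hK' DK']]] hK].
have kM := killed_retract rM hE.2.
have [P hP rK] := retract_rsyz kM hE.2 rM hK hK'.
by exists K', P.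
Qed.

Lemma bounded_syz_sub I k CC DD : (forall M, CC M -> DD M) ->
  bounded (syz I k DD) -> bounded (syz I k CC).
Proof. by move=> h; apply: bounded_sub => K [M /h hM hK]; exists M. Qed.

Lemma bounded_syz_retract_class I k CC DD : is_ideal I ->
    (forall M, CC M -> exists E, [/\ fgmod I E, retract M E & DD E]) ->
  bounded (syz I k DD) -> bounded (syz I k CC).
Proof.
move=> hI h; apply: bounded_syz_retract => // M /h[E [hE rM DE]]; exists E.
by split=> //; have [K hK] := rsyz_exists k hI hE; exists K => //; exists E.
Qed.

Lemma bounded_syz_radd I k G : is_ideal I -> fgmod I G ->
  bounded (syz I k (radd G)).
Proof.
move=> hI hG; have [G' hG'] := rsyz_exists k hI hG.
apply: (bounded_syz_retract (DD := radd G')) => // [M [m rM]|].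
  exists (pow G m); split=> //.
    by case: hG => fG kG; split; [apply: fin_gen_pow | apply: killed_pow].
  exists (pow G' m); first exact: rsyz_pow.
  by exists m; apply: retract_refl.
by apply: bounded_radd; case: (fgmod_rsyz hG hG').
Qed.

(* Horseshoe lemma: [rotate] replaces the middle syzygy by an extension. *)
Lemma rsyz_ext I k A M C K (f : {linear A -> M}) (g : {linear M -> C}) :
    is_ideal I -> short_exact f g -> fgmod I M -> rsyz I k M K ->
  exists A' C' E (u : {linear A' -> E}) (v : {linear E -> C'}),
    [/\ rsyz I k A A', rsyz I k C C', short_exact u v & retract K E].
Proof.
move=> hI; elim: k A M C K f g => [|k IH] A M C K f g e hM.
  move=> /iso_sym/iso_retract rK; exists A, C, M, f, g.
  by split=> //; apply: iso_refl.
move=> /rsyzS[L [hL hK]].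
have hA : fgmod I A.
  have [fi _ _] := e.
  by split; [apply: fin_gen_sub fi hM.1 | apply: killed_inj fi hM.2].
have hLfg := fgmod_rsyz1 hL.
have [P [a [b [hP eP]]]] := hL.
(* [Z] is the kernel of P -> M -> C: a first syzygy of [C], and at the same time an extension of [A]
   by [L]. *)
have [Z [c [d [j [w [eZ ew _]]]]]] := short_exact_pullback eP e.
have hZ : rsyz1 I C Z by exists P, j, w.
have [A1 hA1] := rsyz1_exists hI hA.
have [Q [s [t [hQ eQ]]]] := hA1.
have kZ := (fgmod_rsyz1 hZ).2.
have [_ _ ds] := (short_exactP c d).1 eZ.
have [_ kQ lQ] := hQ.
(* In 0 -> A1 -> L * Q -> Z -> 0 the ends are first syzygies of [A] and [C], and the middle is a
   first syzygy of [M] times a projective module; the induction hypothesis applies to it. *)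
have [i [p ip]] := rotate eZ eQ (lQ _ _ d kZ hA.2 ds).
have hLQ : fgmod I (L * Q)%type by apply: fgmod_prod => //; apply: fgmod_rproj.
have hKQ := rsyz_prod hK (rsyz_rproj k hQ).
have [A' [C' [E [u [v [h1 h2 h3 h4]]]]]] := IH _ _ _ _ _ _ ip hLQ hKQ.
exists A', C', E, u, v; split=> //.
- by apply/rsyzS; exists A1.
- by apply/rsyzS; exists Z.
- exact: retract_trans (retract_fst _ _) h4.
Qed.

Lemma bounded_syz_ext I k CC (AA BB : lmodType R -> Prop) : is_ideal I ->
    (forall M, CC M -> exists A B (f : {linear A -> M}) (g : {linear M -> B}),
       [/\ AA A, BB B, short_exact f g & fgmod I M]) ->
  bounded (syz I k AA) -> bounded (syz I k BB) -> bounded (syz I k CC).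
Proof.
move=> hI h; apply: bounded_ext => K [M /h[A [B [f [g [hA hB e hM]]]]] hK].
have [A' [B' [E [u [v [h1 h2 h3 h4]]]]]] := rsyz_ext hI e hM hK.
by exists A', B', E, u, v; split=> //; [exists A | exists B].
Qed.

Lemma bounded_syz_prod I k CC DD : is_ideal I ->
    (forall M, CC M -> fgmod I M) -> (forall M, DD M -> fgmod I M) ->
    bounded (syz I k CC) -> bounded (syz I k DD) ->
  bounded (syz I k (fun M => exists A B, [/\ CC A, DD B & M = (A * B)%type :> lmodType R])).
Proof.
move=> hI hC hD; apply: bounded_syz_ext => // M [A [B [cA dB ->]]].
have [f [g e]] := short_exact_pair A B; exists A, B, f, g.
by split=> //; apply: fgmod_prod; auto.
Qed.

Lemma is_ideal0 : is_ideal ([set 0] : set R).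
Proof.
by split=> //= [x y -> ->|a x ->]; rewrite ?addr0 ?mulr0.
Qed.

Lemma killed0 M : killed [set 0] M.
Proof. by move=> a x ->; rewrite scale0r. Qed.

(** The horseshoe lemma is applied along the layers of [reach]. It is done over R itself because
    layers and middle terms need not be killed by a larger ideal, even when the module they build
    is. *)
Lemma bounded_syzygy CC : bounded CC -> bounded (syz [set 0] 1 CC).
Proof.
move=> [G [n0 [hG hn]]].
suff h n : bounded (syz [set 0] 1 (reach G n)) by apply: bounded_syz_sub hn (h n0).
have hI := is_ideal0.
elim: n => [|n IH].
  apply: bounded_syz_sub (bounded_syz_radd 1 hI (conj hG (@killed0 G))).
  by move=> M /=; apply: radd_zero.
have bX := bounded_syz_radd 1 hI (conj hG (@killed0 G)).
pose DD E := exists Y X (f : {linear Y -> E}) (g : {linear E -> X}),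
  [/\ reach G n Y, radd G X & short_exact f g].
have hDD E : DD E -> fgmod [set 0] E.
  move=> [Y [X [f [g [/(fin_gen_reach hG) fY /(fin_gen_radd hG) fX e]]]]].
  by split; [apply: fin_gen_ext e fY fX | apply: killed0].
apply: (bounded_syz_retract_class (DD := DD)) => //.
  move=> M [E [Y [X [f [g [rM hY hX e]]]]]].
  have DE : DD E by exists Y, X, f, g.
  by exists E; split=> //; apply: hDD.
apply: bounded_syz_ext IH bX => // E DE; have [Y [X [f [g [hY hX e]]]]] := DE.
by exists Y, X, f, g; split=> //; apply: hDD.
Qed.

(* Change of rings: a syzygy over R/I of an R/J-module is built from its
   syzygies over R/J and the syzygies over R/I of R/J. *)
Lemma bounded_syz_subset I J k CC : is_ideal I -> is_ideal J ->
    (forall a, I a -> J a) -> (forall M, CC M -> fgmod J M) ->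
  bounded (syz J k CC) -> bounded (syz I k CC).
Proof.
move=> hI hJ sIJ; have fJI M : fgmod J M -> fgmod I M.
  by move=> [fM kM]; split=> //; apply: killed_subset kM.
elim: k CC => [|k IH] CC hC bC //.
pose C1 := syz J 1 CC.
have hC1 L : C1 L -> fgmod J L by move=> [M _ [L' _]]; apply: fgmod_rsyz1.
(* The induction is on the order, for all classes at once: the R/J-syzygies of order [k] of [C1] are
   those of order [k.+1] of [CC]. *)
have bC1 : bounded (syz I k C1).
  apply: IH => //; apply: bounded_sub bC => K [L [M hM hL] hK].
  exists M => //; apply/rsyzS; exists L; split=> //.
  by case: hL => M' /rsyz1_isol h /h.
have bF : bounded (syz I k.+1 (rproj J)).
  have [Q [p hp]] := cyclic_exists hJ.
  have hQ := fgmod_rproj (rproj_cyclic hJ hp).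
  apply: bounded_syz_sub (bounded_syz_radd k.+1 hI (fJI _ hQ)) => P.
  exact: rproj_radd hp.
have bD : bounded (syz I k (syz I 1 (rproj J))).
  apply: bounded_sub bF => K [D [F hF [F' hF' hD]] hK]; exists F => //.
  by apply/rsyzS; exists D; split=> //; apply: rsyz1_isol hF' hD.
have bP : bounded (syz I k (rproj I)).
  have [Q [p hp]] := cyclic_exists hI.
  have hQ := fgmod_rproj (rproj_cyclic hI hp).
  apply: bounded_syz_sub (bounded_syz_radd k hI hQ) => P.
  exact: rproj_radd hp.
have bB := bounded_syz_prod hI (fun L h => fJI L (hC1 L h)) (@fgmod_rproj I) bC1 bP.
apply: bounded_ext bD bB => K [N hN /rsyzS[L [hL hK]]].
have [L' hL'] := rsyz1_exists hJ (hC _ hN).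
have [F [f [g [hF e]]]] := hL'.
have [P [u [v [hP e']]]] := hL.
have hFI := fJI _ (fgmod_rproj hF).
have [_ _ lP] := hP.
have [_ _ gs] := (short_exactP f g).1 e.
(* The covers of [N] over R/J and R/I are compared by 0 -> L -> L' * P -> F -> 0. *)
have [i [p ip]] := rotate e e' (lP _ _ g hFI.2 (fJI _ (hC _ hN)).2 gs).
have [D hD] := rsyz1_exists hI hFI.
have [Q [s [t [hQ eQ]]]] := hD.
have hLP : fgmod I (L' * P)%type.
  apply: fgmod_prod; last exact: fgmod_rproj.
  by apply: fJI; apply: fgmod_rsyz1 hL'.
have [_ _ lQ] := hQ.
have [_ _ ps] := (short_exactP i p).1 ip.
(* A cover of [F] over R/I brings [L] to the middle: 0 -> D -> L * Q -> L' * P -> 0. Here [D] is a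
   syzygy over R/I of a projective R/J-module, that is, of a summand of a power of R/J. *)
have [j [q jq]] := rotate ip eQ (lQ _ _ p hLP.2 hFI.2 ps).
have hLQ : fgmod I (L * Q)%type.
  by apply: fgmod_prod; [apply: fgmod_rsyz1 hL | apply: fgmod_rproj].
have hKQ := rsyz_prod hK (rsyz_rproj k hQ).
have [A' [B' [E [x [y [h1 h2 h3 h4]]]]]] := rsyz_ext hI jq hLQ hKQ.
exists A', B', E, x, y; split=> //.
- by exists D => //; exists F => //; exists F => //; apply: iso_refl.
- exists (L' * P)%type => //; exists L', P; split=> //.
  by exists N => //; exists N => //; apply: iso_refl.
- exact: retract_trans (retract_fst _ _) h4.
Qed.

End BoundedSyzygies.

(** * Ideals and dimension *)

Section Ideals.
Variable R : comNzRingType.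
Implicit Types (I J : set R) (p q : prime_idealr R).

Definition add_ideal I (a : R) : set R :=
  [set x | exists y b, I y /\ x = y + b * a].

Lemma is_ideal_add I a : is_ideal I -> is_ideal (add_ideal I a).
Proof.
move=> [I0 ID IM]; split.
- by exists 0, 0; rewrite mul0r addr0.
- move=> _ _ [y [b [Iy ->]]] [y' [b' [Iy' ->]]]; exists (y + y'), (b + b').
  by split; [apply: ID | rewrite mulrDl addrACA].
- move=> c _ [y [b [Iy ->]]]; exists (c * y), (c * b).
  by split; [apply: IM | rewrite mulrDr mulrA].
Qed.

Lemma add_ideal_sub I a x : I x -> add_ideal I a x.
Proof. by move=> Ix; exists x, 0; rewrite mul0r addr0. Qed.

Lemma add_ideal_gen I a : is_ideal I -> add_ideal I a a.
Proof. by move=> [I0 _ _]; exists 0, 1; rewrite mul1r add0r. Qed.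

Lemma add_ideal_proper I a : is_ideal I -> ~ I a -> I `<` add_ideal I a.
Proof.
by move=> hI na; split=> [x|/(_ _ (add_ideal_gen a hI))//]; apply: add_ideal_sub.
Qed.

Lemma is_ideal_prime p : is_ideal [set` p].
Proof.
split=> /= [|x y|a x]; [exact: idealr0 | exact: rpredD | exact: idealMr].
Qed.

Section PrimeOfSet.
Variable I : set R.
Hypotheses (hI : is_ideal I) (n1 : ~ I 1).
Hypothesis hM : forall a b, I (a * b) -> I a \/ I b.

Definition prime_pred (x : R) : bool := `[< I x >].

Fact prime_pred_ideal : idealr_closed prime_pred.
Proof.
case: hI => I0 ID IM; split; [exact/asboolP | exact/asboolP |].
by move=> a x y /asboolP Ix /asboolP Iy; apply/asboolP/ID => //; apply: IM.
Qed.

Fact prime_pred_prime : prime_idealr_closed prime_pred.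
Proof.
by move=> a b /asboolP/hM[h|h]; apply/orP; [left|right]; apply/asboolP.
Qed.

Lemma prime_of_set : exists p, [set` p] = I.
Proof.
pose m1 := isIdealr.Build R prime_pred prime_pred_ideal.
pose m2 := isPrimeIdealrClosed.Build R prime_pred prime_pred_prime.
exists (HB.pack_for (prime_idealr R) prime_pred m1 m2).
by apply/seteqP; split=> x /=; [move/asboolP | move=> Ix; apply/asboolP].
Qed.
End PrimeOfSet.

Lemma ideal_cases I : is_ideal I ->
  [\/ I 1, exists p, [set` p] = I
    | exists a b, [/\ I (a * b), ~ I a & ~ I b]].
Proof.
move=> hI; have [|n1] := pselect (I 1); first by constructor 1.
have [|h] := pselect (exists a b, [/\ I (a * b), ~ I a & ~ I b]).
  by constructor 3.
constructor 2; apply: prime_of_set => // a b Iab.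
have [|na] := pselect (I a); first by left.
have [|nb] := pselect (I b); first by right.
by case: h; exists a, b.
Qed.

Hypothesis hR : noetherian R.

(** A failing ideal would start a strictly ascending chain of failing ideals. The union is an ideal
    with finitely many generators, all contained in some [u k], so the chain stops there. *)
Lemma noetherian_ind (P : set R -> Prop) :
    (forall I, is_ideal I ->
      (forall J, is_ideal J -> I `<` J -> P J) -> P I) ->
  forall I, is_ideal I -> P I.
Proof.
move=> step I0 hI0; apply: contrapT => nP0.
have next (T : {I | is_ideal I /\ ~ P I}) :
    exists T' : {I | is_ideal I /\ ~ P I}, sval T `<` sval T'.
  case: T => I [hI nP] /=; apply: contrapT => h; apply: nP; apply: step => // J hJ IJ.
  by apply: contrapT => nPJ; apply: h; exists (exist _ J (conj hJ nPJ)).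
have [f hf] := choice next.
pose u n := sval (iter n f (exist _ I0 (conj hI0 nP0))).
have hu n : is_ideal (u n) by rewrite /u; case: (iter _ _ _) => I [].
have uS n : u n `<` u n.+1 by apply: hf.
have uP m n : (m <= n)%N -> u m `<=` u n.
  elim: n => [|n IH]; first by rewrite leqn0 => /eqP->.
  rewrite leq_eqVlt => /orP[/eqP-> //|]; rewrite ltnS => /IH h.
  by apply: subset_trans h _; case: (uS n).
have [|n [g eg]] := hR (I := [set x | exists m, u m x]).
  split.
  - by exists 0%N; case: (hu 0%N).
  - move=> x y [m hm] [m' hm']; exists (maxn m m'); case: (hu (maxn m m')) => _ hD _.
    by apply: hD; [apply: uP hm; rewrite leq_maxl | apply: uP hm'; rewrite leq_maxr].
  - by move=> a x [m hm]; exists m; case: (hu m) => _ _; apply.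
have /choice[m hm] : forall i, exists m, u m (g i).
  move=> i; have : [set x | exists m, u m x] (g i); last by [].
  rewrite eg; exists (fun j => (j == i)%:R).
  rewrite (bigD1 i) //= eqxx mul1r big1 ?addr0 // => j /negPf ->.
  by rewrite mul0r.
pose k := \max_(i < n) m i.
case: (uS k) => _; apply=> x hx.
have : [set x | exists m, u m x] x by exists k.+1.
rewrite eg => -[c ->]; case: (hu k) => h0 hD hM.
apply: (big_rec (u k)) => // i z _ hz; apply: hD => //; apply: hM.
by apply: uP (hm i); apply: leq_bigmax.
Qed.

Lemma prime_above I : is_ideal I -> ~ I 1 -> exists p, I `<=` [set` p].
Proof.
move: I; apply: (noetherian_ind (P := fun I => ~ I 1 -> exists p, I `<=` [set` p])).
move=> I hI IH n1; have [//|[p <-]|[a [b [Iab na nb]]]] := ideal_cases hI.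
  by exists p.
have [|p hp] := IH _ (is_ideal_add a hI) (add_ideal_proper hI na).
  (* If 1 = y + c a with [y] in [I], then b = b y + c a b would lie in [I]. *)
  move=> [y [c [Iy e1]]]; apply: nb.
  have -> : b = b * y + c * (a * b).
    by rewrite -{1}[b]mulr1 e1 mulrDr; congr (_ + _); rewrite mulrC mulrA.
  by case: hI => _ ID IM; apply: ID; apply: IM.
by exists p; apply: subset_trans hp => x; apply: add_ideal_sub.
Qed.

(* dim R/I < e *)
Definition dim_lt I e := forall n (p : 'I_n.+1 -> prime_idealr R),
  prime_chain p -> (forall i, I `<=` [set` p i]) -> (n < e)%N.

(** A single prime is already a chain of length 0, so the strict bound 0 says that no prime contains
    [I]. This is where the descent in dimension ends. *)
Lemma dim_lt0 I : is_ideal I -> dim_lt I 0 -> I 1.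
Proof.
move=> hI h; apply: contrapT => /(prime_above hI)[p hp].
suff : (0 < 0)%N by [].
by apply: (h 0%N (fun=> p)) => // i j; rewrite !ord1.
Qed.

Lemma dim_lt_sub I J e : I `<=` J -> dim_lt I e -> dim_lt J e.
Proof.
by move=> IJ h n p hp hJ; apply: (h n p hp) => i; apply: subset_trans (hJ i).
Qed.

(** [p] can be put below any chain of primes containing p + (a): they all contain [a], so the
    inclusion is strict. *)
Lemma dim_lt_prime p a e : ~ (a \in p) -> dim_lt [set` p] e.+1 ->
  dim_lt (add_ideal [set` p] a) e.
Proof.
move=> na h n q hq hJ.
have pq i : [set` p] `<` [set` q i].
  split=> [x px|]; first by apply: hJ; apply: add_ideal_sub.
  by move=> qp; apply: na; apply: qp; apply: hJ; apply/add_ideal_gen/is_ideal_prime.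
pose q' (i : 'I_n.+2) := if unlift ord0 i is Some j then q j else p.
suff : (n.+1 < e.+1)%N by [].
apply: (h n.+1 q') => [i j|i]; rewrite /q'.
  case: unliftP => [i' ->|->]; case: unliftP => [j' ->|->] //.
  by rewrite !lift0 ltnS; apply: hq.
by case: unliftP => [i' _|_] //; case: (pq i').
Qed.

End Ideals.

(** * Annihilators of Ext *)

Section Annihilators.
Variable S : comNzRingType.
Implicit Types A B C E F G K L M N P Q T W X Y Z : lmodType S.

Lemma surjP (A B : Type) (f : A -> B) : surj f <-> forall y, exists x, f x = y.
Proof.
split=> [h y|h]; last by apply/seteqP; split=> // y _; have [x <-] := h y; exists x.
by have : [set: B] y by []; rewrite -h => -[x _ <-]; exists x.
Qed.

Lemma projectiveP P :
  fin_gen P -> projective P <-> rproj [set 0] P.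
Proof.
move=> fP; split=> [h|[_ _ h] A B g f /surjP gs]; last first.
  by apply: h => //; apply: killed0.
by split=> // [|A B g _ _ /surjP gs f]; [apply: killed0 | apply: h].
Qed.

(** Only the augmentation changes, so cocycles and coboundaries stay the same. Stating the transfer
    of killing avoids an equality between the two complexes. *)
Lemma resolution_iso M N (f : {linear M -> N}) (P : proj_resolution M) :
  bijective f ->
  exists Q : proj_resolution N,
    forall a i (W : lmodType S),
      (forall g : res_obj Q i -> W, ext_cocycle g ->
         ext_coboundary (P := Q) (fun x => a *: g x)) ->
      forall g : res_obj P i -> W, ext_cocycle g ->
        ext_coboundary (P := P) (fun x => a *: g x).
Proof.
case: P => o d aug op augs ex0 ex fb.
have s : surj (f \o aug).
  apply/surjP => y; case: fb => h _ fh; have [x ex'] := (surjP _).1 augs (h y).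
  by exists x; rewrite /= ex' fh.
have e0 : exact_at (d 0) (f \o aug).
  rewrite /exact_at ex0; apply/seteqP; split=> x /=; first by move=> ->; rewrite linear0.
  by rewrite -(linear0 f) => /(bij_inj fb).
by exists (ProjResolution op s e0 ex).
Qed.

Lemma ext_killed_iso a i M X N :
  iso M X -> ext_killed a i M N -> ext_killed a i X N.
Proof.
move=> /iso_sym[f fb] h P g hg; have [Q hQ] := resolution_iso P fb.
by apply: hQ hg => g' /h.
Qed.

Lemma exact_at_surj A B C E (f : {linear A -> B}) (g : {linear B -> C})
  (q : {linear E -> A}) : short_exact f g -> surj q -> exact_at (f \o q) g.
Proof.
case=> _ fg _ /surjP qs; rewrite /exact_at -fg; apply/seteqP; split=> _ [x _ <-].
  by exists (q x).
by have [y <-] := qs x; exists y.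
Qed.

Lemma exact_at_inj A B C E (f : {linear A -> B}) (u : {linear C -> E})
  (q : {linear E -> A}) : exact_at u q -> injective f -> exact_at u (f \o q).
Proof.
move=> uq fi; rewrite /exact_at uq; apply/seteqP; split=> x /=.
  by move=> ->; rewrite linear0.
by rewrite -(linear0 f) => /fi.
Qed.

Section Splice.
Variables (L P M : lmodType S) (f : {linear L -> P}) (g : {linear P -> M}).
Hypotheses (hP : projective P) (hfg : short_exact f g).
Variable Q : proj_resolution L.

Definition splice_obj i : lmodType S := if i is j.+1 then res_obj Q j else P.

Definition splice_diff i : {linear splice_obj i.+1 -> splice_obj i} :=
  match i with 0 => f \o res_aug Q | j.+1 => res_diff Q j end.

Lemma splice_proj i : projective (splice_obj i).
Proof. by case: i => [|i] //=; apply: res_proj. Qed.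

Lemma splice_exact0 : exact_at (splice_diff 0) g.
Proof. exact: exact_at_surj hfg (res_aug_surj Q). Qed.

Lemma splice_exact i : exact_at (splice_diff i.+1) (splice_diff i).
Proof.
case: i => [|i]; last exact: res_exact.
by apply: exact_at_inj; [exact: res_exact0 | case: hfg].
Qed.

Definition splice : proj_resolution M :=
  ProjResolution splice_proj (let: And3 _ _ h := hfg in h) splice_exact0
    splice_exact.
End Splice.

(** Dimension shift: the spliced complex is the resolution of [L] moved up by one, so the two
    conditions agree by conversion. The degree for [L] has to be positive, since Ext^0(L, N) and
    Ext^1(M, N) differ in their coboundaries. *)
Lemma ext_killed_syzygy1 a i M L N :
  is_syzygy1 M L -> ext_killed a i.+2 M N -> ext_killed a i.+1 L N.
Proof.
move=> [P [f [g [_ hP e]]]] h Q c hc.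
exact: (h (splice hP e Q) c hc).
Qed.

Lemma ext_killed_syzygy a k M X N : is_syzygy k M X ->
  forall i, ext_killed a (k + i.+1) M N -> ext_killed a i.+1 X N.
Proof.
elim: k X => [|k IH] X /=; first by move=> h i; apply: ext_killed_iso.
move=> [L /IH h /ext_killed_syzygy1 h1] i hi; apply: h1; apply: h.
by rewrite addnS -addSn.
Qed.

Hypothesis hS : noetherian S.

(** Bundling lets a cover chosen for every finitely generated module be iterated into a
    resolution. *)
Record fgm := Fgm { fg_car : lmodType S; fg_prop : fin_gen fg_car }.

Record fg_cover (M : fgm) := FgCover {
  cov_ker : fgm; cov_obj : lmodType S;
  cov_in : {linear fg_car cov_ker -> cov_obj};
  cov_out : {linear cov_obj -> fg_car M};
  cov_proj : projective cov_obj;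
  cov_exact : short_exact cov_in cov_out }.

Lemma fg_cover_exists (M : fgm) : inhabited (fg_cover M).
Proof.
have hM : fgmod [set 0] (fg_car M) by split; [apply: fg_prop | apply: killed0].
have [K hK] := rsyz1_exists (is_ideal0 S) hM.
have fK := (fgmod_rsyz1 hS hK).1; have [P [f [g [hP e]]]] := hK.
have pP : projective P by apply/projectiveP => //; case: hP.
by constructor; apply: (@FgCover M (Fgm fK) P f g).
Qed.

(** [ext_killed] quantifies over resolutions and says nothing until one is at hand. *)
Lemma resolution_exists M : fin_gen M -> inhabited (proj_resolution M).
Proof.
move=> fM.
have h (N : fgm) : exists x : fg_cover N, True by have [x] := fg_cover_exists N; exists x.
pose c (N : fgm) := sval (cid (h N)).
pose u := fix u n := if n is k.+1 then cov_ker (c (u k)) else Fgm fM.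
pose d i : {linear cov_obj (c (u i.+1)) -> cov_obj (c (u i))} :=
  cov_in (c (u i)) \o cov_out (c (u i.+1)).
have so (N : fgm) : surj (cov_out (c N)) by case: (cov_exact (c N)).
have ex0 i : exact_at (d i) (cov_out (c (u i))).
  exact: exact_at_surj (cov_exact _) (so _).
constructor; apply: (@ProjResolution S M (fun i => cov_obj (c (u i))) d (cov_out (c (u 0)))).
- by move=> i; apply: cov_proj.
- exact: so.
- exact: ex0.
- by move=> i; apply: exact_at_inj; [exact: ex0 | case: (cov_exact (c (u i)))].
Qed.

(** By dimension shift Ext^1(X, Z) is Ext^{k+1}(M, Z), which [a] kills. Applied to the class of the
    extension 0 -> Z -> F -> X -> 0, this says that multiplication by [a] on [Z] extends to [F]. *)
Lemma ca_split a s k M X Z F (f : {linear Z -> F}) (g : {linear F -> X}) :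
    ca S s a -> fin_gen M -> is_syzygy k M X -> (s <= k.+1)%N ->
    fin_gen F -> projective F -> short_exact f g ->
  exists h : {linear F -> Z}, forall z, h (f z) = a *: z.
Proof.
move=> ha fM hX sk fF pF e; have [fi _ _] := e.
have fZ : fin_gen Z := fin_gen_sub hS fi fF.
have [Q] := resolution_exists fZ.
have hk : ext_killed a 1 X Z.
  by apply: ext_killed_syzygy hX _ _; rewrite addn1; apply: ha.
(* In the resolution spliced from [Q] and the extension, the class of the extension is the 1-cocycle
   given by the augmentation of [Q]. *)
have [|h hh] := hk (splice pF e Q) (res_aug Q).
  split=> [|x]; first exact: linearP.
  have := res_exact0 Q; rewrite /exact_at => /seteqP[h _].
  by apply: h; exists x.
exists h => z; have [x <-] := (surjP _).1 (res_aug_surj Q) z.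
by rewrite hh.
Qed.

End Annihilators.

(** * Modules over R/p and R-modules killed by p *)

Section ChangeOfRings.
Variables (R : comNzRingType) (p : prime_idealr R).
Local Notation S := {ideal_quot p}.
Local Notation I := [set` p].
Implicit Types M N P K X Z : lmodType R.
Implicit Types A B : lmodType S.

Definition res (a : R) : S := \pi_S a.

Lemma resM a b : res (a * b) = res a * res b.
Proof. exact: Quotient.pi_mul. Qed.
Lemma resD a b : res (a + b) = res a + res b.
Proof. exact: Quotient.pi_add. Qed.
Lemma res1 : res 1 = 1.
Proof. exact: lock. Qed.
Lemma res_surj (c : S) : exists a : R, c = res a.
Proof. by exists (repr c); rewrite /res reprK. Qed.
Lemma res_eq a b : res a = res b <-> a - b \in p.
Proof.
have -> : (a - b \in p) = (res a == res b) by apply: Quotient.idealrBE.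
by split=> /eqP.
Qed.

(* An R-module killed by [p], seen as an R/p-module. *)
Definition up M (kM : killed I M) : Type := M.

Section Up.
Variables (M : lmodType R) (kM : killed I M).
HB.instance Definition _ := GRing.Zmodule.on (up kM).
Definition up_scale (c : S) (x : up kM) : up kM := (repr c *: (x : M) : M).

Lemma up_scaleE a x : up_scale (res a) x = a *: (x : M).
Proof.
apply/eqP; rewrite -subr_eq0 -scalerBl kM //=.
by apply/res_eq; rewrite /res reprK.
Qed.

Fact up_scaleA a b v : up_scale a (up_scale b v) = up_scale (a * b) v.
Proof.
have [x ->] := res_surj a; have [y ->] := res_surj b.
by rewrite -resM !up_scaleE scalerA.
Qed.
Fact up_scale1 : left_id 1 up_scale.
Proof. by move=> v; rewrite -res1 up_scaleE scale1r. Qed.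
Fact up_scaleDr : right_distributive up_scale +%R.
Proof. by move=> a u v; apply: scalerDr. Qed.
Fact up_scaleDl v : {morph up_scale^~ v : a b / a + b}.
Proof.
move=> a b; have [x ->] := res_surj a; have [y ->] := res_surj b.
by rewrite -resD !up_scaleE scalerDl.
Qed.
HB.instance Definition _ := GRing.Zmodule_isLmodule.Build S (up kM)
  up_scaleA up_scale1 up_scaleDr up_scaleDl.

Lemma up_resE a (x : up kM) : res a *: x = a *: (x : M).
Proof. exact: up_scaleE. Qed.
End Up.

(* Restriction of scalars along R -> R/p. *)
Definition down A : Type := A.

Section Down.
Variable A : lmodType S.
HB.instance Definition _ := GRing.Zmodule.on (down A).
Definition down_scale (a : R) (x : down A) : down A := (res a *: (x : A) : A).
Fact down_scaleA a b v : down_scale a (down_scale b v) = down_scale (a * b) v.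
Proof. by rewrite /down_scale resM scalerA. Qed.
Fact down_scale1 : left_id 1 down_scale.
Proof. by move=> v; rewrite /down_scale res1 scale1r. Qed.
Fact down_scaleDr : right_distributive down_scale +%R.
Proof. by move=> a u v; apply: scalerDr. Qed.
Fact down_scaleDl v : {morph down_scale^~ v : a b / a + b}.
Proof. by move=> a b; rewrite /down_scale resD scalerDl. Qed.
HB.instance Definition _ := GRing.Zmodule_isLmodule.Build R (down A)
  down_scaleA down_scale1 down_scaleDr down_scaleDl.

Lemma down_resE a (x : down A) : a *: x = res a *: (x : A).
Proof. by []. Qed.

Lemma killed_down : killed I (down A).
Proof.
move=> a x Ia; rewrite down_resE.
have -> : res a = res 0 by apply/res_eq; rewrite subr0.
have -> : res 0 = 0 by apply: (addrI (res 0)); rewrite -resD !addr0.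
exact: (scale0r (x : A)).
Qed.
End Down.

Lemma up_linear M N (kM : killed I M) (kN : killed I N) (f : {linear M -> N}) :
  exists g : {linear up kM -> up kN}, forall x : M, g x = f x.
Proof.
apply: (lin_ex (f := f : up kM -> up kN)) => c x y.
have [a ->] := res_surj c; rewrite !up_resE; exact: linearP.
Qed.

Lemma up_linear_inv M N (kM : killed I M) (kN : killed I N)
    (g : {linear up kM -> up kN}) :
  exists f : {linear M -> N}, forall x : M, f x = g x.
Proof.
apply: (lin_ex (f := g : M -> N)) => a x y.
have := linearP g (res a) x y; by rewrite !up_resE.
Qed.

Lemma down_linear A B (f : {linear A -> B}) :
  exists g : {linear down A -> down B}, forall x : A, g x = f x.
Proof. apply: (lin_ex (f := f : down A -> down B)) => c x y; exact: linearP. Qed.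

Lemma up_fin_gen M (kM : killed I M) : fin_gen M -> fin_gen (up kM).
Proof.
move=> [n [g hg]]; exists n, g => x; have [c e] := hg x.
exists (fun i => res (c i)); rewrite e; apply: eq_bigr => i _.
by rewrite up_resE.
Qed.

(** A lifting problem over R/p is restricted to R by [down], solved among modules killed by [p], and
    its solution is linear over R/p again. *)
Lemma up_projective P (kP : killed I P) : rproj I P -> projective (up kP).
Proof.
move=> [_ _ lP] A B g f /surjP gs.
have [g' eg] := down_linear g.
have [f' ef] : exists f' : {linear P -> down B}, forall x : P, f' x = f x.
  apply: (lin_ex (f := f : P -> down B)) => a x y.
  by have := linearP f (res a) x y; rewrite up_resE.
have [|h hh] := lP _ _ g' (@killed_down A) (@killed_down B) _ f'.
  by move=> y; have [x ex] := gs y; exists x; rewrite eg.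
have [h' eh] : exists h' : {linear up kP -> A}, forall x : P, h' x = h x.
  apply: (lin_ex (f := h : up kP -> A)) => c x y.
  by have [a ->] := res_surj c; rewrite up_resE; apply: (linearP h).
by exists h' => x; rewrite eh -eg hh ef.
Qed.

Lemma up_short_exact K P M (kK : killed I K) (kP : killed I P) (kM : killed I M)
    (f : {linear K -> P}) (g : {linear P -> M}) : short_exact f g ->
  exists (f' : {linear up kK -> up kP}) (g' : {linear up kP -> up kM}),
    [/\ short_exact f' g', forall x : K, f' x = f x & forall x : P, g' x = g x].
Proof.
move=> /short_exactP[fi fg gs].
have [f' ef] := up_linear kK kP f; have [g' eg] := up_linear kP kM g.
exists f', g'; split=> //; apply/short_exactP; split.
- by move=> x y; rewrite !ef; apply: fi.
- by move=> y; rewrite eg; split=> [/fg[x <-]|[x <-]];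
    [exists x; rewrite ef | apply/fg; exists x; rewrite ef].
- by move=> z; have [y ey] := gs z; exists y; rewrite eg.
Qed.

Lemma up_rsyz k M K (kM : killed I M) (kK : killed I K) :
  rsyz I k M K -> is_syzygy k (up kM) (up kK).
Proof.
elim: k K kK => [|k IH] K kK /=.
  move=> [f [g fg gf]]; have [h eh] := up_linear kM kK f.
  by exists h, g => x; rewrite ?eh // fg.
move=> [L hL [P [f [g [hP e]]]]].
have kL := killed_rsyz kM hL; have kP : killed I P by case: hP.
exists (up kL); first exact: IH.
have [f' [g' [e' _ _]]] := up_short_exact kK kP kL e.
exists (up kP), f', g'; split=> //; last exact: up_projective.
by apply: up_fin_gen; case: hP.
Qed.

Lemma noetherian_quot : noetherian R -> noetherian S.
Proof.
move=> hR J [J0 JD JM].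
have r0 : res 0 = 0 by apply: (addrI (res 0)); rewrite -resD !addr0.
have [|n [g eg]] := hR [set a | J (res a)].
  split=> /=; first by rewrite r0.
    by move=> x y hx hy; rewrite resD; apply: JD.
  by move=> a x hx; rewrite resM; apply: JM.
have rsum (c : 'I_n -> R) : res (\sum_i c i * g i) = \sum_i res (c i) * res (g i).
  apply: (big_rec2 (fun x y => res x = y)) => // i y x _ e.
  by rewrite resD resM e.
exists n, (fun i => res (g i)); apply/seteqP; split=> x /=.
  have [a ->] := res_surj x; move=> Ja.
  have : [set a | J (res a)] a by [].
  by rewrite eg => -[c ->]; exists (fun i => res (c i)).
move=> [c ->]; apply: (big_rec J) => // i y _ hy; apply: JD => //; apply: JM.
suff : [set a | J (res a)] (g i) by [].
rewrite eg; exists (fun j => (j == i)%:R).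
rewrite (bigD1 i) //= eqxx mul1r big1 ?addr0 // => j /negPf ->.
by rewrite mul0r.
Qed.

(** The hypothesis on Ext concerns R/p-modules, so the cover and the syzygy are carried there; only
    the resulting map comes back, and what follows stays within R-modules. *)
Lemma ca_split_rel a s k M X Z P (f : {linear Z -> P}) (g : {linear P -> X}) :
    noetherian R -> ca S s (res a) -> fgmod I M -> rsyz I k M X ->
    (s <= k.+1)%N -> rproj I P -> short_exact f g ->
  exists h : {linear P -> Z}, forall z, h (f z) = a *: z.
Proof.
move=> hR ha [fM kM] hX sk hP e.
have kX := killed_rsyz kM hX; have kP : killed I P by case: hP.
have kZ : killed I Z by case: e => fi _ _; apply: killed_inj fi kP.
have [f' [g' [e' ef eg]]] := up_short_exact kZ kP kX e.
have fP : fin_gen (up kP) by apply: up_fin_gen; case: hP.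
have hX' : is_syzygy k (up kM) (up kX) by apply: up_rsyz.
have [h hh] := ca_split (noetherian_quot hR) ha (up_fin_gen kM fM) hX' sk fP
  (up_projective (kP := kP) hP) e'.
have [h' eh] := up_linear_inv h; exists h' => z.
by rewrite eh -ef hh up_resE.
Qed.

Lemma ca_witness s : ca S s <> [set 0] -> exists2 a, ~ (a \in p) & ca S s (res a).
Proof.
move=> h; apply: contrapT => nh; apply: h; apply/seteqP; split=> [c hc|_ ->].
  apply: contrapT => c0; apply: nh; have [a ea] := res_surj c.
  exists a; last by rewrite -ea.
  move=> pa; apply: c0 => /=; rewrite ea.
  have -> : res a = res 0 by apply/res_eq; rewrite subr0.
  by apply: (addrI (res 0)); rewrite -resD !addr0.
(* The assumption is an inequality of sets, so its contrapositive also requires 0 to be in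
   [ca S s]. *)
move=> M N [|i] _ _ _ P f _ /=; first by move=> x; rewrite scale0r.
have [g eg] := lin_zero (res_obj P i) N.
by exists g => x; rewrite scale0r eg.
Qed.

End ChangeOfRings.

(** * Reduction to primes and descent in dimension *)

Section Reduction.
Variable R : comNzRingType.
Implicit Types A B C E F G K L M N P Q T W X Y Z : lmodType R.
Implicit Types (a : R) (m n : nat) (I J : set R).

Definition coker_mul a X T (t : {linear X -> T}) :=
  (forall y, exists x, t x = y) /\ forall x, t x = 0 <-> exists y, x = a *: y.

Lemma coker_mul_exists a X : exists T (t : {linear X -> T}), coker_mul a t.
Proof.
apply: (@quo_exists R X [set x | exists y, x = a *: y]); split=> /=.
- by exists 0; rewrite scaler0.
- by move=> _ _ [x ->] [y ->]; exists (x + y); rewrite scalerDr.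
- by move=> b _ [x ->]; exists (b *: x); rewrite !scalerA mulrC.
Qed.

Lemma coker_mulE a X T (t : {linear X -> T}) x : coker_mul a t -> t (a *: x) = 0.
Proof. by case=> _ h; apply/h; exists x. Qed.

Lemma coker_mul_fgmod I a X T (t : {linear X -> T}) :
  coker_mul a t -> fgmod I X -> fgmod (add_ideal I a) T.
Proof.
move=> ht [fX kX]; have [ts _] := ht; split; first exact: fin_gen_image ts fX.
move=> _ y [u [b [Iu ->]]]; have [x <-] := ts y.
have ea : a *: t x = 0 by rewrite -(coker_mulE x ht) linearZ.
have eu : u *: t x = 0 by rewrite -linearZ /= kX // linear0.
by rewrite scalerDl -scalerA ea eu scaler0 addr0.
Qed.

Lemma inj_linear A B (f : {linear A -> B}) :
  (forall x, f x = 0 -> x = 0) -> injective f.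
Proof.
move=> h x y e; apply/eqP; rewrite -subr_eq0; apply/eqP/h.
by rewrite linearB e subrr.
Qed.

Definition torsion_free a X := forall x : X, a *: x = 0 -> x = 0.

Lemma torsion_free_inj a X Y (f : {linear X -> Y}) :
  injective f -> torsion_free a Y -> torsion_free a X.
Proof.
move=> fi h x e; apply: fi; rewrite linear0; apply: h.
by rewrite -linearZ /= e linear0.
Qed.

Lemma coker_mul_rproj I a P T (t : {linear P -> T}) : is_ideal I ->
  coker_mul a t -> rproj I P -> rproj (add_ideal I a) T.
Proof.
move=> hI ht hP; have [fP kP lP] := hP.
have [fT kT] := coker_mul_fgmod ht (conj fP kP).
split=> // A B g kA kB gs f.
have kI M : killed (add_ideal I a) M -> killed I M.
  by apply: killed_subset => x; apply: add_ideal_sub.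
have [h hh] := lP _ _ g (kI _ kA) (kI _ kB) gs (f \o t).
have [ts tk] := ht; have [|h' hh'] := lin_factor (f := h) ts.
  move=> x /tk[y ->]; rewrite linearZ /= kA //.
  by exists 0, 1; rewrite mul1r add0r; split=> //; case: hI.
by exists h' => y; have [x <-] := ts y; rewrite hh' hh.
Qed.

(** Reduction modulo [a] stays exact on the left because [L] has no a-torsion: if f k = a y, then a
    g(y) = 0, so g(y) = 0 and [y] comes from [K]. *)
Lemma coker_mul_rsyz1 I a K P L T T' (f : {linear K -> P}) (g : {linear P -> L})
    (t : {linear K -> T}) (t' : {linear L -> T'}) : is_ideal I ->
    torsion_free a L -> rproj I P -> short_exact f g ->
    coker_mul a t -> coker_mul a t' ->
  rsyz1 (add_ideal I a) T' T.
Proof.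
move=> hI tfL hP /short_exactP[fi fg gs] ht ht'.
have [U [u hu]] := coker_mul_exists a P.
have [ts tk] := ht; have [ts' tk'] := ht'; have [us uk] := hu.
have [|v hv] := lin_factor (f := u \o f) ts.
  by move=> x /tk[y ->]; rewrite /= linearZ /= (coker_mulE _ hu).
have [|w hw] := lin_factor (f := t' \o g) us.
  by move=> x /uk[y ->]; rewrite /= linearZ /= (coker_mulE _ ht').
have gf k : g (f k) = 0 by apply/fg; exists k.
exists U, v, w; split; first exact: coker_mul_rproj hu hP.
apply/short_exactP; split.
- apply: inj_linear => z; have [k <-] := ts z; rewrite hv /= => /uk[y ey].
  have /fg[k' ek'] : g y = 0 by apply: tfL; rewrite -linearZ /= -ey gf.
  by apply/tk; exists k'; apply: fi; rewrite ey linearZ /= ek'.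
- move=> z; have [y <-] := us z; rewrite hw /=; split=> [/tk'[x ex]|[q]].
    have [y' ey'] := gs x.
    have /fg[k ek] : g (y - a *: y') = 0 by rewrite linearB linearZ /= ey' ex subrr.
    by exists (t k); rewrite hv /= ek linearB (coker_mulE _ hu) subr0.
  have [k <-] := ts q; rewrite hv /= => e.
  by rewrite -[t' (g y)]hw -e hw /= gf linear0.
- move=> z; have [x <-] := ts' z; have [y <-] := gs x.
  by exists (u y); rewrite hw.
Qed.

(** Torsion-freeness is part of the induction: each syzygy embeds in a projective module, so it
    inherits the property that the next reduction needs. *)
Lemma coker_mul_rsyz I a k M X T T' (t : {linear X -> T}) (t' : {linear M -> T'}) :
    is_ideal I -> (forall P, rproj I P -> torsion_free a P) ->
    torsion_free a M -> rsyz I k M X -> coker_mul a t -> coker_mul a t' ->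
  torsion_free a X /\ rsyz (add_ideal I a) k T' T.
Proof.
move=> hI tfP tfM; elim: k X T t => [|k IH] X T t /=.
  move=> h ht ht'; have [i [r ri]] := iso_retract (iso_sym h).
  split; first by apply: torsion_free_inj tfM; apply: can_inj ri.
  have [f fb] := h; have [ts tk] := ht; have [ts' tk'] := ht'.
  have [|v hv] := lin_factor (f := t \o f) ts'.
    by move=> x /tk'[y ->]; rewrite /= linearZ /= (coker_mulE _ ht).
  have [f' fK f'K] := fb.
  have [||w [vw wv]] := @bij_linear _ _ _ v; last by exists v, w.
    apply: inj_linear => z; have [x <-] := ts' z; rewrite hv /= => /tk[y ey].
    apply/tk'; exists (f' y); apply: (can_inj fK).
    by rewrite ey linearZ /= f'K.
  by move=> z; have [x <-] := ts z; exists (t' (f' x)); rewrite hv /= f'K.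
move=> [L hL [P [f [g [hP e]]]]] ht ht'.
have [U [u hu]] := coker_mul_exists a L.
have [tfL hU] := IH _ _ _ hL hu ht'.
split; last by exists U => //; apply: coker_mul_rsyz1 tfL hP e ht hu.
by have [fi _ _] := e; apply: torsion_free_inj fi (tfP _ hP).
Qed.

Lemma torsion_free_rproj (p : prime_idealr R) a P :
  ~ (a \in p) -> rproj [set` p] P -> torsion_free a P.
Proof.
move=> na hP; have hI := is_ideal_prime p; have [Q [q hq]] := cyclic_exists hI.
have tfQ : torsion_free a Q.
  move=> y; have [qs qk] := hq; have [b <-] := qs y.
  rewrite -linearZ /= => /qk /=; rewrite [_ *: _]/(a * b) prime_idealrM.
  by case/orP=> // pb; apply/qk.
have [m [i [r ri]]] := rproj_radd hI hq hP.
apply: (torsion_free_inj (can_inj ri)); elim: m {i r ri} => [|m IH].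
  by move=> x _; apply: zero_pow0.
by move=> [x y] [/tfQ -> /IH ->].
Qed.

Hypothesis hR : noetherian R.

(* A splitting h : P -> Z of Z -> P up to the factor a yields the exact sequence
   0 -> X * Z -> P -> X/aX -> 0. *)
Lemma short_exact_coker_mul a X Z P T (f : {linear Z -> P}) (g : {linear P -> X})
    (h : {linear P -> Z}) (t : {linear X -> T}) :
    short_exact f g -> (forall z, h (f z) = a *: z) -> torsion_free a X ->
    coker_mul a t ->
  exists i : {linear (X * Z)%type -> P}, short_exact i (t \o g).
Proof.
move=> /short_exactP[fi fg gs] hf tfX [ts tk].
have gf k : g (f k) = 0 by apply/fg; exists k.
(* a - f h vanishes on the image of [Z], so it factors through [g] as a map s : X -> P with g s =
   a. *)
have [d ed] : exists d : {linear P -> P}, d =1 fun v => a *: v - f (h v).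
  apply: lin_ex => c x y; rewrite (linearP h) (linearP f) scalerDr opprD addrACA.
  by rewrite scalerBr !scalerA mulrC.
have [|s hs] := lin_factor (f := d) gs.
  by move=> x /fg[z <-]; rewrite ed hf linearZ subrr.
have gs' x : g (s x) = a *: x.
  by have [v <-] := gs x; rewrite hs ed linearB gf subr0 linearZ.
have [i ei] : exists i : {linear (X * Z)%type -> P}, i =1 fun x => s x.1 + f x.2.
  by apply: lin_ex => c x y /=; rewrite !linearP scalerDr addrACA.
exists i; apply/short_exactP; split.
- apply: inj_linear => -[x z]; rewrite ei /= => e.
  have ex : x = 0.
    by apply: tfX; rewrite -gs' -[LHS]addr0 -(gf z) -linearD e linear0.
  move: e; rewrite ex linear0 add0r -(linear0 f) => /fi ->; exact: erefl.
- move=> v /=; split=> [/tk[x ex]|[[x z] <-]].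
    have [z ez] : exists z, f z = v - s x.
      by apply/fg; rewrite linearB gs' ex subrr.
    by exists (x, z); rewrite ei /= ez addrC subrK.
  by apply/tk; exists x; rewrite ei /= linearD gs' gf addr0.
- by move=> y; have [x <-] := ts y; have [v <-] := gs x; exists v.
Qed.

(** [TT] is a class containing all quotients X/aX: the zero modules in dimension 0, and syzygies
    over R/(p + (a)) in higher dimension. *)
Lemma prime_step (p : prime_idealr R) a s k (TT : lmodType R -> Prop) :
    ca {ideal_quot p} s (res p a) -> (s <= k.+1)%N -> bounded TT ->
    (forall M X T (t : {linear X -> T}),
       fgmod [set` p] M -> rsyz [set` p] k M X -> coker_mul a t ->
       torsion_free a X /\ TT T) ->
  bounded (syz [set` p] k (fgmod [set` p])).
Proof.
move=> ha sk bT hT; have hI := is_ideal_prime p.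
apply: bounded_ext (bounded_syzygy hR bT) (bounded_rproj hI) => X [M hM hX].
have hXfg := fgmod_rsyz hR hM hX.
have [T [t ht]] := coker_mul_exists a X; have [tfX TTT] := hT _ _ _ _ hM hX ht.
have [Z [P [f [g [hP e]]]]] := rsyz1_exists hI hXfg.
have [h hh] := ca_split_rel hR ha hM hX sk hP e.
have [i ie] := short_exact_coker_mul e hh tfX ht.
have hTfg : fgmod [set 0] T.
  split; last exact: killed0.
  by case: ht => ts _; apply: fin_gen_image ts _; case: hXfg.
have [K hK] := rsyz1_exists (is_ideal0 R) hTfg.
have [Q [u [v [[_ _ lQ] eQ]]]] := hK.
have [_ _ ps] := (short_exactP _ _).1 ie.
(* This moves [X] to the middle: 0 -> K -> (X * Z) * Q -> P -> 0, with [K] a syzygy of a module of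
   [TT]. *)
have [j [q jq]] := rotate ie eQ (lQ _ _ _ (@killed0 _ P) (@killed0 _ T) ps).
exists K, P, ((X * Z) * Q)%type, j, q; split=> //.
  by exists T => //; exists T => //; apply: iso_refl.
exact: retract_trans (retract_fst _ _) (retract_fst _ _).
Qed.

Lemma zero_rsyz_unit I k M K : I 1 -> fgmod I M -> rsyz I k M K -> zero_mod K.
Proof.
move=> I1 hM /(fgmod_rsyz hR hM)[_ kK] x.
by rewrite -[x]scale1r kK.
Qed.

(* Noetherian induction: if ab is in I then aM is killed by I + (b) and M/aM by
   I + (a). *)
Lemma bounded_syz_of_primes k e :
    (forall p : prime_idealr R, dim_lt [set` p] e ->
       bounded (syz [set` p] k (fgmod [set` p]))) ->
  forall I, is_ideal I -> dim_lt I e -> bounded (syz I k (fgmod I)).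
Proof.
move=> hp; apply: (noetherian_ind hR) => I hI IH hd.
have [I1|[p ep]|[a [b [Iab na nb]]]] := ideal_cases hI.
- apply: bounded_sub (bounded_zero R) => K [M hM]; exact: zero_rsyz_unit hM.
- by rewrite -ep; apply: hp; rewrite ep.
(* The induction hypothesis is about syzygies over R/(I + (c)); [bounded_syz_subset] converts it to
   syzygies over R/I. *)
have add c : ~ I c -> bounded (syz I k (fgmod (add_ideal I c))).
  move=> nc; have hc := is_ideal_add c hI.
  apply: (bounded_syz_subset hR hI hc) => [x|//|]; first exact: add_ideal_sub.
  apply: IH => //; first exact: add_ideal_proper.
  by apply: dim_lt_sub hd => x; apply: add_ideal_sub.
apply: (bounded_syz_ext hR hI) (add b nb) (add a na) => M hM.
have [T [t ht]] := coker_mul_exists a M; have [ts tk] := ht.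
have [N [f [fi fN]]] : exists N (f : {linear N -> M}),
    injective f /\ forall x, (exists y, x = a *: y) <-> exists z, f z = x.
  apply: (@sub_exists R M [set x | exists y, x = a *: y]); split=> /=.
  - by exists 0; rewrite scaler0.
  - by move=> _ _ [x ->] [y ->]; exists (x + y); rewrite scalerDr.
  - by move=> c _ [x ->]; exists (c *: x); rewrite !scalerA mulrC.
exists N, T, f, t; split=> //; last 1 first.
- by apply/short_exactP; split=> // y; rewrite tk.
- have [fM kM] := hM; split; first exact: fin_gen_sub fi fM.
  move=> _ z [u [c [Iu ->]]]; apply: fi.
  have [y ey] : exists y, f z = a *: y by apply/fN; exists z.
  rewrite linear0 linearZ /= ey scalerDl (kM u) // add0r !scalerA kM //.
  by case: hI => _ _ hI'; rewrite -mulrA [b * a]mulrC; apply: hI'.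
- exact: coker_mul_fgmod ht hM.
Qed.

(** The exponent of the annihilator is [s.+1] and the dimension is at most [e], so [s + e] is
    exponent plus dimension minus one, without a truncated subtraction. *)
Lemma bounded_syz_fgmod s e I :
    (forall p : prime_idealr R, ca {ideal_quot p} s.+1 <> [set 0]) ->
  is_ideal I -> dim_lt I e.+1 -> bounded (syz I (s + e) (fgmod I)).
Proof.
move=> hca; elim: e I => [|e IHe] I hI; apply: bounded_syz_of_primes hI => p hd;
  have hp := is_ideal_prime p; have [a na ha] := ca_witness (hca p);
  have hJ := is_ideal_add a hp; have hdJ := dim_lt_prime na hd.
  apply: (prime_step ha _ (bounded_zero R)) => [|M X T t hM hX ht].
    by rewrite addn0.
  (* In dimension 0 the ideal p + (a) contains 1, so [a] acts invertibly on modules killed by [p]: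
     X/aX is zero and [X] has no a-torsion. *)
  have J1 := dim_lt0 hR hJ hdJ.
  have zT : zero_mod T.
    have [_ kT] := coker_mul_fgmod ht (fgmod_rsyz hR hM hX).
    by move=> x; rewrite -[x]scale1r kT.
  split=> // x ex; have [_ kX] := fgmod_rsyz hR hM hX.
  have [y [b [py e1]]] := J1.
  by rewrite -[x]scale1r e1 scalerDl -scalerA ex scaler0 addr0 kX.
rewrite addnS; apply: (prime_step ha _ (IHe _ hJ hdJ)) => [|M X T t hM].
  by rewrite !ltnS leqW // leq_addr.
(* [X] is read as a syzygy of order s + e of [L], which is torsion-free although [M] may not be. *)
move=> /rsyzS[L [hL hX]] ht.
have [T' [t' ht']] := coker_mul_exists a L.
have tfP P : rproj [set` p] P -> torsion_free a P by apply: torsion_free_rproj.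
have tfL : torsion_free a L.
  case: hL => P [f [g [hP [fi _ _]]]]; exact: torsion_free_inj fi (tfP _ hP).
have [tfX hT] := coker_mul_rsyz hp tfP tfL hX ht ht'; split=> //.
by exists T' => //; apply: coker_mul_fgmod ht' (fgmod_rsyz1 hR hL).
Qed.

End Reduction.

(** * From retracts back to direct summands and [ball] *)

Section Conclusion.
Variable R : comNzRingType.
Implicit Types E F G K L M N P Q W X Y : lmodType R.

Lemma rsyz_of_is_syzygy k M K : is_syzygy k M K -> rsyz [set 0] k M K.
Proof.
elim: k K => // k IH K [L /IH hL [P [f [g [fP pP e]]]]].
by exists L => //; exists P, f, g; split=> //; apply/projectiveP.
Qed.

Lemma retract_pow_ffun G m : retract (pow G m) {ffun 'I_m -> G}.
Proof.
elim: m => [|m [i [r ri]]]; first by apply: zero_retract; apply: zero_pow0.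
have [i' ei] : exists i' : {linear pow G m.+1 -> {ffun 'I_m.+1 -> G}},
    i' =1 fun x => [ffun k => if unlift ord0 k is Some j then i x.2 j else x.1].
  apply: lin_ex => c x y; apply/ffunP => k; rewrite !ffunE.
  by case: unliftP => //= j _; rewrite linearP !ffunE.
have [r' er] : exists r' : {linear {ffun 'I_m.+1 -> G} -> pow G m.+1},
    r' =1 fun u => (u ord0, r [ffun j => u (lift ord0 j)]).
  apply: lin_ex => c x y; apply: injective_projections; rewrite /= ?ffunE //.
  by rewrite -linearP; congr (r _); apply/ffunP => j; rewrite !ffunE.
exists i', r' => -[x y]; rewrite er ei !ffunE unlift_none; congr pair.
rewrite -[RHS]ri; congr (r _); apply/ffunP => j.
by rewrite !ffunE liftK.
Qed.

Lemma add_mod_of_radd G X : radd G X -> add_mod G X.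
Proof.
move=> [m hX]; exists m; apply: retract_complement.
exact: retract_trans hX (retract_pow_ffun G m).
Qed.

(** Level one of [reach] extends add G by a zero module and so adds nothing. Above it, the
    complement of [M] in [E] is the module [W] that [ball] asks for; it is finitely generated
    because [E] is. *)
Lemma ball_of_reach G n M : fin_gen G -> reach G n.+1 M -> ball G n.+1 M.
Proof.
move=> hG; elim: n M => [|n IH] M hM.
  move: hM => [E [Y [X [f [g [rM hY [m hX] e]]]]]].
  apply: add_mod_of_radd; exists m; apply: retract_trans rM _.
  apply: retract_trans hX; have [_ fg gs] := (short_exactP f g).1 e.
  have [|h [gh hg]] := bij_linear (f := g) _ gs; last by exists g, h.
  by apply: inj_linear => y /fg[x <-]; rewrite [x]hY linear0.
split; first exact: fin_gen_reach hM.
move: hM => [E [Y [X [f [g [rM hY hX e]]]]]].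
have {}hY : reach G n.+1 Y := hY.
have [W [q [q' qK q'K]]] := retract_complement rM.
have [q'l [h1 h2]] := @bij_linear _ _ _ q (can_inj qK) (fun y => ex_intro _ (q' y) (q'K y)).
have fE : fin_gen E.
  exact: fin_gen_ext e (fin_gen_reach hG hY) (fin_gen_radd hG hX).
exists W, Y, X, (q'l \o f), (g \o q); split.
- apply: fin_gen_retract fE; apply: retract_trans (retract_snd M W) _.
  by exists q, q'l.
- exact: IH.
- exact: add_mod_of_radd.
have [fi fg gs] := (short_exactP f g).1 e.
apply/short_exactP; split=> /=.
- by move=> x y /= /(can_inj h2)/fi.
- move=> y; rewrite fg; split=> [[x ex]|[x <-]]; last by exists x; rewrite h2.
  by exists x; rewrite ex h1.
- by move=> z; have [y <-] := gs z; exists (q'l y); rewrite h2.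
Qed.

End Conclusion.

Theorem theorem5p1 (R : comNzRingType) (d : nat) (s : nat)
    (hR : noetherian R) (hd : has_krull_dim R d) (hs : (0 < s)%N)
    (hca : forall p : prime_idealr R, ca {ideal_quot p} s <> [set 0]) :
  (exists (G : lmodType R) (n : nat),
     fin_gen G /\
     forall K : lmodType R, Omega_mod (s + d - 1) K -> ball G n K) /\
  (exists G : lmodType R, strong_generator G).
Proof.
case: s hs hca => // s _ hca.
have hdim : dim_lt [set 0 : R] d.+1 by move=> n p hp _; case: hd => _ /(_ n p hp).
have [G [n [hG hn]]] := bounded_syz_fgmod hR hca (is_ideal0 R) hdim.
(* The level is raised by one because [ball_of_reach] needs a positive level. *)
have {}hn K : Omega_mod (s.+1 + d - 1) K -> reach G n.+1 K.
  rewrite addSn subn1 /= => -[M fM /rsyz_of_is_syzygy hK].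
  by apply/reachS/hn; exists M => //; split=> //; apply: killed0.
split; first by exists G, n.+1; split=> // K /hn; apply: ball_of_reach.
have hG' : fin_gen (R^o * G)%type.
  apply: fin_gen_prod hG; apply/fin_genP; exists [:: 1] => x.
  by exists x; rewrite [_ *: _]mulr1 subrr.
exists (R^o * G)%type; split=> //; first by exists G; apply: iso_refl.
exists (s.+1 + d - 1)%N, n.+1 => K /hn hK; apply: ball_of_reach => //.
exact: reach_gen (retract_snd _ _) hK.
Qed.
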